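(* Assume: $\mathrm L$ is a spline-admissible operator with null space $\mathcal N_{\mathrm L}$ of dimension $N_0\ge0$, null-space frequencies $\{\bm k_1,\dots,\bm k_{N_0}\}$, pseudoinverse $\mathrm L^\dagger$ and Green's function $g_{\mathrm L}=\mathrm L^\dagger Ш$; $\nu_1,\dots,\nu_M\in\mathcal C_{\mathrm L}(\mathbb T^d)$ are linearly independent, $M\ge N_0$, and $\bm\nu=(\nu_1,\dots,\nu_M)$ is injective on $\mathcal N_{\mathrm L}$ (i.e. $p\in\mathcal N_{\mathrm L}$ and $\langle\nu_m,p\rangle=0$ for all $m$ imply $p=0$); $E:\mathbb R^M\times\mathbb R^M\to\mathbb R_+\cup\{\infty\}$ is such that $E(\bm z,\cdot)$ is lower semi-continuous, convex, coercive and proper for each $\bm z\in\mathbb R^M$; $\bm y\in\mathbb R^M$; and $\lambda>0$. Then the solution set $$\mathcal V=\arg\min_{f\in\mathcal M_{\mathrm L}(\mathbb T^d)}\ E(\bm y,\bm\nu(f))+\lambda\|\mathrm Lf\|_{\mathcal M},\qquad \bm\nu(f)=(\langle\nu_1,f\rangle,\dots,\langle\nu_M,f\rangle),$$ is nonempty, convex and compact for the weak* topology of $\mathcal M_{\mathrm L}(\mathbb T^d)$ (as dual of $\mathcal C_{\mathrm L}(\mathbb T^d)$). Moreover, every extreme point of $\mathcal V$ is a periodic $\mathrm L$-spline of the form $f_{\mathrm{ext}}=\sum_{k=1}^Ka_kg_{\mathrm L}(\cdot-\bm x_k)+p$ with $K\le M$, $\bm x_k\in\mathbb T^d$, $p\in\mathcal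 N_{\mathrm L}$, and $\bm a=(a_1,\dots,a_K)\in\mathbb R^K$ satisfying $\mathbf M\bm a=\bm 0$, where $M[n,k]=e^{-\mathrm i\langle\bm k_n,\bm x_k\rangle}$.
   Context: Let $d\ge1$, $\mathbb T^d=\mathbb R^d/2\pi\mathbb Z^d$, $\mathcal S(\mathbb T^d)$ the smooth periodic functions and $\mathcal S'(\mathbb T^d)$ its dual; for $f\in L_1$, $\langle f,\varphi\rangle=(2\pi)^{-d}\int f\varphi$. With $e_{\bm k}(\bm x)=e^{\mathrm i\langle\bm x,\bm k\rangle}$, each $f\in\mathcal S'$ expands uniquely as $f=\sum\widehat f[\bm k]e_{\bm k}$ with slowly growing coefficients. The Dirac comb $Ш$ is given by $\langle Ш,\varphi\rangle=\varphi(\bm 0)$. Operators in $\mathcal L_{\mathrm{SI}}(\mathcal S'(\mathbb T^d))$ act by $\mathrm Lf=\sum\widehat L[\bm k]\widehat f[\bm k]e_{\bm k}$ with slowly growing $\widehat L$; $\mathrm L^*$ has Fourier sequence $\overline{\widehat L[\bm k]}$. $\mathrm L$ is spline-admissible if its null space $\mathcal N_{\mathrm L}$ is finite-dimensional and it admits a pseudoinverse $\mathrm L^\dagger\in\mathcal L_{\mathrm{SI}}$ ($\mathrm L\mathrm L^\dagger\mathrm L=\mathrm L$, $\mathrm L^\dagger\mathrm L\mathrm L^\dagger=\mathrm L^\dagger$, $\mathrm L\mathrm L^\dagger$ and $\mathrm L^\dagger\mathrm L$ self-adjoint); then $N_{\mathrm L}=\{\bm k:\widehat L[\bm k]=0\}=\{\bm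 k_1,\dots,\bm k_{N_0}\}$, $\mathcal N_{\mathrm L}=\mathrm{Span}\{e_{\bm k_n}\}$, $\mathrm L^\dagger$ has Fourier sequence $1/\widehat L[\bm k]$ off $N_{\mathrm L}$ and $0$ on it, and $\mathrm{Proj}_{\mathcal N_{\mathrm L}}f:=\sum_n\widehat f[\bm k_n]e_{\bm k_n}$. $\mathcal C(\mathbb T^d)$: continuous periodic functions with $\|\cdot\|_\infty$; $\mathcal M(\mathbb T^d)=\mathcal C(\mathbb T^d)'$: periodic finite Radon measures with total variation norm $\|\cdot\|_{\mathcal M}$, viewed inside $\mathcal S'$. Native space $\mathcal M_{\mathrm L}(\mathbb T^d)=\{f\in\mathcal S':\mathrm Lf\in\mathcal M(\mathbb T^d)\}$ (norm $\|\mathrm Lf\|_{\mathcal M}+\|\mathrm{Proj}_{\mathcal N_{\mathrm L}}f\|_2$); measurement space $\mathcal C_{\mathrm L}(\mathbb T^d)=\{g\in\mathcal S':(\mathrm L^\dagger)^*g\in\mathcal C(\mathbb T^d)\}$ (norm $\max(\|(\mathrm L^\dagger)^*g\|_\infty,\|\mathrm{Proj}_{\mathcal N_{\mathrm L}}g\|_2)$); $\mathcal M_{\mathrm L}$ is the dual of $\mathcal C_{\mathrm L}$, so $\langle\nu,f\rangle$ is defined for $\nu\in\mathcal C_{\mathrm L}$, $f\in\mathcal M_{\mathrm L}$. A periodic $\mathrm L$-spline is $f\in\mathcal S'$ with $\mathrm Lf=\sum_{k=1}^Ka_kШ(\cdot-\bm x_k)$ for finitely many knots $\bm x_k$ and weights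 $a_k$. *)

(* Defs.v *)
(* Periodic generalized functions on T^d are
   represented by their Fourier coefficient sequences. *)
From mathcomp Require Import all_boot all_order all_algebra.
From mathcomp Require Import all_classical all_reals all_analysis.
From mathcomp Require Import complex.
Set Implicit Arguments. Unset Strict Implicit. Unset Printing Implicit Defensive.
Import Order.TTheory GRing.Theory Num.Theory ComplexField.
Import numFieldNormedType.Exports.
Local Open Scope classical_set_scope.
Local Open Scope ring_scope.
Local Open Scope complex_scope.

Section PeriodicDefs.
Variables (R : realType) (d : nat).

Definition Zd := {ffun 'I_d -> int}.
(* points of the torus, through a representative in R^d *)
Definition Td := 'I_d -> R.

Definition dotp (x : Td) (k : Zd) : R := \sum_(j < d) x j * (k j)%:~R.

Definition cexpi (t : R) : R[i] := (cos t +i* sin t).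

Definition knorm (k : Zd) : nat := \sum_(j < d) `|k j|%N.

Definition slow_growth (c : Zd -> R[i]) : Prop :=
  exists (A : R) (N : nat), forall k : Zd,
    `|c k| <= (A * ((knorm k).+1)%:R ^+ N)%:C.

(* Fourier sequence of a real-valued object *)
Definition hermitian (c : Zd -> R[i]) : Prop := forall k : Zd, c (- k) = (c k)^*.

(* f in S'(T^d) (real-valued), identified with f = sum_k fhat[k] e_k *)
Definition gen_fun (f : Zd -> R[i]) : Prop := slow_growth f /\ hermitian f.

(* L in L_SI(S'(T^d)), given by its Fourier sequence Lhat *)
Definition SI_op (Lh : Zd -> R[i]) : Prop := slow_growth Lh /\ hermitian Lh.

Definition Lapp (Lh f : Zd -> R[i]) : Zd -> R[i] := fun k => Lh k * f k.

Definition in_null (Lh p : Zd -> R[i]) : Prop := gen_fun p /\ forall k, Lapp Lh p k = 0.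

Definition null_finite_dim (Lh : Zd -> R[i]) : Prop :=
  exists (n : nat) (b : 'I_n -> (Zd -> R[i])),
    forall p, in_null Lh p ->
      exists c : 'I_n -> R, p = (fun k => \sum_(i < n) (c i)%:C * b i k).

Definition spline_admissible (Lh : Zd -> R[i]) : Prop :=
  SI_op Lh /\ null_finite_dim Lh /\
  exists Ld : Zd -> R[i], SI_op Ld /\
    (forall k, Lh k * Ld k * Lh k = Lh k) /\
    (forall k, Ld k * Lh k * Ld k = Ld k) /\
    (forall k, (Lh k * Ld k)^* = Lh k * Ld k) /\
    (forall k, (Ld k * Lh k)^* = Ld k * Lh k).

Definition Ldag (Lh : Zd -> R[i]) : Zd -> R[i] :=
  fun k => if Lh k == 0 then 0 else (Lh k)^-1.

(* trigonometric polynomials: sum_{k in tsupp} tco k e_k *)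
Record trig := Trig { tsupp : seq Zd; tco : Zd -> R[i] }.

Definition tcoef (q : trig) (k : Zd) : R[i] := if k \in tsupp q then tco q k else 0.

Definition teval (q : trig) (x : Td) : R[i] :=
  \sum_(k <- undup (tsupp q)) tco q k * cexpi (dotp x k).

Definition real_trig (q : trig) : Prop := hermitian (tcoef q).

(* u in C(T^d): uniform limit of (real) trigonometric polynomials
   whose Fourier coefficients converge to those of u *)
Definition is_cont (u : Zd -> R[i]) : Prop :=
  exists q : nat -> trig, (forall n, real_trig (q n)) /\
   (forall e : R, 0 < e -> exists N : nat, forall n m : nat, (N <= n)%N -> (N <= m)%N ->
        forall x : Td, `|complex.Re (teval (q n) x) - complex.Re (teval (q m) x)| <= e) /\
   (forall k, (fun n => complex.Re (tcoef (q n) k)) @ \oo --> complex.Re (u k)) /\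
   (forall k, (fun n => complex.Im (tcoef (q n) k)) @ \oo --> complex.Im (u k)).

Definition tpair (u : Zd -> R[i]) (q : trig) : R :=
  complex.Re (\sum_(k <- undup (tsupp q)) u (- k) * tco q k).

(* total-variation norm, as the norm of u viewed as a functional on C(T^d)
   (trigonometric polynomials being dense in C(T^d)) *)
Definition TVnorm (u : Zd -> R[i]) : \bar R :=
  ereal_sup [set (`|tpair u q|)%:E | q in
     [set q | real_trig q /\ forall x : Td, `|complex.Re (teval q x)| <= 1]].

Definition is_measure (u : Zd -> R[i]) : Prop := gen_fun u /\ (TVnorm u < +oo)%E.

Definition ML (Lh f : Zd -> R[i]) : Prop := gen_fun f /\ is_measure (Lapp Lh f).

(* measurement space C_L(T^d) : (L^dagger)^* g in C(T^d) *)
Definition CL (Lh g : Zd -> R[i]) : Prop :=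
  gen_fun g /\ is_cont (fun k => (Ldag Lh k)^* * g k).

Definition box (N : nat) : seq Zd :=
  map (fun t : {ffun 'I_d -> 'I_(N.*2.+1)} =>
         [ffun j : 'I_d => (nat_of_ord (t j))%:Z - N%:Z] : Zd)
      (enum {ffun 'I_d -> 'I_(N.*2.+1)}).

Definition fejer (N : nat) (k : Zd) : R :=
  \prod_(j < d) (1 - (`|k j|%N)%:R / (N.+1)%:R).

(* duality pairing <g, f> for g in C_L, f in M_L (Cesaro/Fejer summation of
   sum_k ghat[k] fhat[-k]) *)
Definition wpair (g f : Zd -> R[i]) : R :=
  limn (fun N : nat => complex.Re (\sum_(k <- box N) (fejer N k)%:C * g k * f (- k))).

Definition wstar_open (Lh : Zd -> R[i]) (O : set (Zd -> R[i])) : Prop :=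
  O `<=` ML Lh /\
  forall f, O f -> exists (n : nat) (g : 'I_n -> (Zd -> R[i])) (e : R),
    (forall i, CL Lh (g i)) /\ 0 < e /\
    [set f' | ML Lh f' /\ forall i, `|wpair (g i) f' - wpair (g i) f| < e] `<=` O.

Definition wstar_compact (Lh : Zd -> R[i]) (S : set (Zd -> R[i])) : Prop :=
  S `<=` ML Lh /\
  forall (I : Type) (O : I -> set (Zd -> R[i])),
    (forall i, wstar_open Lh (O i)) -> (forall f, S f -> exists i, O i f) ->
    exists (n : nat) (h : 'I_n -> I), forall f, S f -> exists j, O (h j) f.

Definition comb (t : R) (f1 f2 : Zd -> R[i]) : Zd -> R[i] :=
  fun k => t%:C * f1 k + (1 - t)%:C * f2 k.

Definition real_convex_set (S : set (Zd -> R[i])) : Prop :=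
  forall f1 f2 t, S f1 -> S f2 -> 0 <= t <= 1 -> S (comb t f1 f2).

Definition extreme_point (S : set (Zd -> R[i])) (f : Zd -> R[i]) : Prop :=
  S f /\ forall f1 f2 t, S f1 -> S f2 -> 0 < t < 1 -> f = comb t f1 f2 -> f1 = f2.

Definition nuvec (M : nat) (nu : 'I_M -> (Zd -> R[i])) (f : Zd -> R[i]) : 'rV[R]_M :=
  \row_(m < M) wpair (nu m) f.

Definition solution_set (M : nat) (Lh : Zd -> R[i]) (nu : 'I_M -> (Zd -> R[i]))
    (E : 'rV[R]_M -> 'rV[R]_M -> \bar R) (y : 'rV[R]_M) (lam : R) : set (Zd -> R[i]) :=
  let J := fun f => (E y (nuvec nu f) + lam%:E * TVnorm (Lapp Lh f))%E in
  [set f | ML Lh f /\ forall g, ML Lh g -> (J f <= J g)%E].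

End PeriodicDefs.

(* Main.v *)
(* A measure with Fourier sequence [v] is only used through its action on
   trigonometric polynomials, so no representation theorem is needed.

   Compactness and existence.  The Fejer multipliers contract the sup norm, so
   the pairing with an element of C_L is, uniformly on TV-bounded sets, a limit
   of functionals depending on finitely many Fourier coefficients.  On a
   sublevel set of the objective the coefficients are pointwise bounded
   (coercivity and injectivity of [nu] on the null space control the null-space
   part), and lower semicontinuity makes the set closed for pointwise
   convergence; Tychonoff's theorem gives compactness, and the solution set is
   a sublevel set.

   Extreme points.  If [phi] is a real trigonometric polynomial with
   [|phi| <= 1], then [TV((1+phi)m) + TV((1-phi)m) <= 2 TV(m)].  Hence for
   [m = L f], [f] extreme, a dimension count shows that any [M+1] multiples
   [phi_i m] are linearly dependent, i.e. the translates of the Fourier sequence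
   of [m] span a space of dimension at most [M].  The coordinate shifts are
   commuting operators on that space with bounded orbits, hence simultaneously
   diagonalizable with unimodular eigenvalues, and [m] is a sum of at most [M]
   Dirac masses. *)
Require Import Defs.
From mathcomp Require Import all_boot all_order all_algebra.
From mathcomp Require Import all_classical all_reals all_analysis.
From mathcomp Require Import complex.
From mathcomp Require Import ring lra zify.
Set Implicit Arguments. Unset Strict Implicit. Unset Printing Implicit Defensive.
Import Order.TTheory GRing.Theory Num.Theory ComplexField.
Import numFieldNormedType.Exports.
Local Open Scope classical_set_scope.
Local Open Scope ring_scope.
Local Open Scope complex_scope.

(** The total variation of L f says nothing about the coefficients of f at the null frequencies, so
    these are split off throughout ([off_null], [on_null]) and controlled through the measurements.
    Weak* neighbourhoods are compared with coefficientwise ones under a TV bound, and for this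
    reason the topological arguments live on sublevel sets. Linear independence of [nu] serves
    existence: every measurement vector is attained, so a point of finite objective is available.
    Convexity and extremality concern real scalars, whereas the shifts are diagonalized over the
    complex numbers; Hermitian symmetry passes between the two without raising the dimension above
    M. *)

Section ComplexParts.
Variable R : realType.
Implicit Types (z w : R[i]) (a : R).

Lemma cReD z w : complex.Re (z + w) = complex.Re z + complex.Re w.
Proof. by case: z w => [? ?] []. Qed.
Lemma cReN z : complex.Re (- z) = - complex.Re z.
Proof. by case: z. Qed.
Lemma cImN z : complex.Im (- z) = - complex.Im z.
Proof. by case: z. Qed.
Lemma cImD z w : complex.Im (z + w) = complex.Im z + complex.Im w.
Proof. by case: z w => [? ?] []. Qed.
Lemma cReM z w : complex.Re (z * w) =
  complex.Re z * complex.Re w - complex.Im z * complex.Im w.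
Proof. by case: z w => [? ?] []. Qed.
Lemma cImM z w : complex.Im (z * w) =
  complex.Re z * complex.Im w + complex.Im z * complex.Re w.
Proof. by case: z w => [? ?] []. Qed.
Lemma cReMl a z : complex.Re (a%:C * z) = a * complex.Re z.
Proof. by rewrite cReM /= mul0r subr0. Qed.
Lemma cImMl a z : complex.Im (a%:C * z) = a * complex.Im z.
Proof. by rewrite cImM /= mul0r addr0. Qed.
Lemma cReJ z : complex.Re z^* = complex.Re z.
Proof. by case: z. Qed.
Lemma cImJ z : complex.Im z^* = - complex.Im z.
Proof. by case: z. Qed.
Lemma cRe_sum (I : Type) (s : seq I) (P : pred I) (F : I -> R[i]) :
  complex.Re (\sum_(i <- s | P i) F i) = \sum_(i <- s | P i) complex.Re (F i).
Proof. by elim/big_rec2: _ => // i x y _ <-; rewrite cReD. Qed.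
Lemma cIm_sum (I : Type) (s : seq I) (P : pred I) (F : I -> R[i]) :
  complex.Im (\sum_(i <- s | P i) F i) = \sum_(i <- s | P i) complex.Im (F i).
Proof. by elim/big_rec2: _ => // i x y _ <-; rewrite cImD. Qed.
Lemma complex_eqP z w :
  complex.Re z = complex.Re w -> complex.Im z = complex.Im w -> z = w.
Proof. by case: z w => [? ?] [? ?] /= -> ->. Qed.

Lemma num_conjE z : Num.conj z = conjc z.
Proof. by []. Qed.
Lemma real_complexM (a b : R) : (a * b)%:C = a%:C * b%:C.
Proof. exact: rmorphM. Qed.
Lemma real_complexD (a b : R) : (a + b)%:C = a%:C + b%:C.
Proof. exact: rmorphD. Qed.

Lemma cexpiD (s t : R) : cexpi (s + t) = cexpi s * cexpi t.
Proof. by apply: complex_eqP => /=; rewrite ?cosD ?sinD // addrC [_ * cos t]mulrC. Qed.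
Lemma cexpi0 : cexpi (0 : R) = 1.
Proof. by rewrite /cexpi cos0 sin0. Qed.
Lemma cexpiN (t : R) : cexpi (- t) = (cexpi t)^*.
Proof. by rewrite /cexpi cosN sinN. Qed.
Lemma cexpiMn (t : R) n : cexpi (n%:R * t) = cexpi t ^+ n.
Proof.
elim: n => [|n IH]; first by rewrite mul0r cexpi0 expr0.
by rewrite -natr1 mulrDl mul1r cexpiD IH exprSr.
Qed.
End ComplexParts.

(** * Trigonometric polynomials as lists of monomials *)

Section Lists.
Variables (R : realType) (d : nat).
Notation Z := (Zd d).
Notation C := (R[i]).

Lemma dotpDl (x y : Td R d) (k : Z) : dotp (fun j => x j + y j) k = dotp x k + dotp y k.
Proof. by rewrite /dotp -big_split; apply: eq_bigr => j _; rewrite mulrDl. Qed.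
Lemma dotpDr (x : Td R d) (k l : Z) : dotp x (k + l) = dotp x k + dotp x l.
Proof. by rewrite /dotp -big_split; apply: eq_bigr => j _; rewrite ffunE intrD mulrDr. Qed.
Lemma dotpNr (x : Td R d) (k : Z) : dotp x (- k) = - dotp x k.
Proof. by rewrite /dotp -sumrN; apply: eq_bigr => j _; rewrite ffunE mulrNz mulrN. Qed.

(* A trigonometric polynomial is a list of monomials (k, z),
   possibly with repeated frequencies; evaluation, Fourier coefficients and
   duality pairings are all instances of [lin]. *)
Definition tlist := seq (Z * C).
Implicit Types (t : tlist) (G u v : Z -> C) (k l : Z).

Definition lin G t : C := \sum_(p <- t) p.2 * G p.1.
Definition ev t (x : Td R d) : C := lin (fun k => cexpi (dotp x k)) t.
Definition coef t k : C := lin (fun l => (l == k)%:R) t.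
Definition lpair u t : R := complex.Re (lin (fun k => u (- k)) t).
Definition tscale (a : C) t : tlist := [seq (p.1, a * p.2) | p <- t].
Definition tmul t1 t2 : tlist := [seq (p.1 + q.1, p.2 * q.2) | p <- t1, q <- t2].
Definition tconj t : tlist := [seq (- p.1, p.2^*) | p <- t].
Definition tweight (w : Z -> C) t : tlist := [seq (p.1, w p.1 * p.2) | p <- t].
Definition trealpart t : tlist := tscale (2^-1)%:C (t ++ tconj t).
(* Fourier sequence of the product of the trigonometric polynomial [t] and [u] *)
Definition act t u : Z -> C := fun k => lin (fun l => u (k - l)) t.

Lemma lin_cat G t1 t2 : lin G (t1 ++ t2) = lin G t1 + lin G t2.
Proof. by rewrite /lin big_cat. Qed.
Lemma lin_scale G a t : lin G (tscale a t) = a * lin G t.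
Proof. by rewrite /lin big_map mulr_sumr; apply: eq_bigr => p _; rewrite mulrA. Qed.
Lemma lin_weight G w t : lin G (tweight w t) = lin (fun k => w k * G k) t.
Proof. by rewrite /lin big_map; apply: eq_bigr => p _ /=; rewrite [w _ * _]mulrC mulrA. Qed.
Lemma lin_conj G t : lin G (tconj t) = (lin (fun k => (G (- k))^*) t)^*.
Proof.
rewrite /lin big_map rmorph_sum; apply: eq_bigr => p _ /=.
by rewrite rmorphM /= conjcK.
Qed.
Lemma lin_mul G t1 t2 : lin G (tmul t1 t2) = lin (fun k => lin (fun l => G (k + l)) t2) t1.
Proof.
rewrite /lin /tmul big_allpairs_dep /=; apply: eq_bigr => p _.
by rewrite mulr_sumr; apply: eq_bigr => q _; rewrite mulrA.
Qed.
Lemma lin_ext G1 G2 t : (forall k, G1 k = G2 k) -> lin G1 t = lin G2 t.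
Proof. by move=> H; apply: eq_bigr => p _; rewrite H. Qed.
Lemma linMl a G t : lin (fun k => a * G k) t = a * lin G t.
Proof. by rewrite /lin mulr_sumr; apply: eq_bigr => p _; rewrite mulrCA. Qed.
Lemma linMr a G t : lin (fun k => G k * a) t = lin G t * a.
Proof. by rewrite /lin mulr_suml; apply: eq_bigr => p _; rewrite mulrA. Qed.
Lemma lin_sum (I : Type) (s : seq I) (P : pred I) (F : I -> Z -> C) t :
  lin (fun k => \sum_(i <- s | P i) F i k) t = \sum_(i <- s | P i) lin (F i) t.
Proof.
rewrite /lin exchange_big /=; apply: eq_bigr => p _.
by rewrite mulr_sumr.
Qed.

Lemma sum_pick (s : seq Z) k (F : Z -> C) : uniq s ->
  \sum_(l <- s) (k == l)%:R * F l = (k \in s)%:R * F k.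
Proof.
move=> us; have [ks|ks] := boolP (k \in s).
  rewrite (bigD1_seq k) //= eqxx mul1r big1 ?addr0 ?mul1r //.
  by move=> l lk; rewrite eq_sym (negbTE lk) mul0r.
rewrite mul0r big_seq big1 // => l ls.
by case: eqP => [kl|_]; rewrite ?mul0r //; move: ks; rewrite kl ls.
Qed.

Lemma sum_coef (s : seq Z) G t : uniq s ->
  \sum_(k <- s) coef t k * G k = lin (fun k => (k \in s)%:R * G k) t.
Proof.
move=> us; rewrite /coef /lin; under eq_bigr => k _ do rewrite mulr_suml.
rewrite exchange_big /=; apply: eq_bigr => p _.
under eq_bigr => k _ do rewrite -mulrA.
by rewrite -mulr_sumr sum_pick.
Qed.

Lemma linE_coef G t : lin G t = \sum_(k <- undup (unzip1 t)) coef t k * G k.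
Proof.
rewrite sum_coef ?undup_uniq // /lin big_seq [RHS]big_seq; apply: eq_bigr => p pt.
by rewrite mem_undup map_f // mul1r.
Qed.

(** Repeated frequencies do no harm: [lin] factors through the collected coefficients, so lists may
    be compared frequency by frequency. *)
Lemma lin_coef_eq G t1 t2 : coef t1 =1 coef t2 -> lin G t1 = lin G t2.
Proof.
move=> H; pose s := undup (unzip1 t1 ++ unzip1 t2).
have key t : {subset unzip1 t <= s} -> lin G t = \sum_(k <- s) coef t k * G k.
  move=> st; rewrite sum_coef ?undup_uniq // /lin big_seq [RHS]big_seq.
  by apply: eq_bigr => p pt; rewrite st ?map_f // mul1r.
rewrite !key; first by apply: eq_bigr => k _; rewrite H.
  by move=> k; rewrite mem_undup mem_cat => ->; rewrite orbT.
by move=> k; rewrite mem_undup mem_cat => ->.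
Qed.

Lemma coef_notin t k : k \notin unzip1 t -> coef t k = 0.
Proof.
move=> kt; rewrite /coef /lin big_seq big1 // => p pt.
by case: eqP => [pk|_]; rewrite ?mulr0 //; move: kt; rewrite -pk map_f.
Qed.

Definition trig_of t : trig R d := Trig (unzip1 t) (coef t).
Definition list_of (q : trig R d) : tlist := [seq (k, tco q k) | k <- undup (tsupp q)].

Lemma tcoef_trig_of t : tcoef (trig_of t) =1 coef t.
Proof. by move=> k; rewrite /tcoef /=; case: ifPn => // /coef_notin. Qed.
Lemma teval_trig_of t x : teval (trig_of t) x = ev t x.
Proof. by rewrite /ev linE_coef. Qed.
Lemma tpair_trig_of u t : tpair u (trig_of t) = lpair u t.
Proof.
rewrite /tpair /lpair linE_coef; congr complex.Re.
by apply: eq_bigr => k _; rewrite mulrC.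
Qed.
Lemma ev_list_of q x : ev (list_of q) x = teval q x.
Proof. by rewrite /ev /lin big_map. Qed.
Lemma coef_list_of q : coef (list_of q) =1 tcoef q.
Proof.
move=> k; rewrite /coef /lin big_map /tcoef /=.
under eq_bigr => l _ do rewrite mulrC eq_sym.
by rewrite sum_pick ?undup_uniq // mem_undup; case: ifP; rewrite ?mul1r ?mul0r.
Qed.
Lemma pair_list_of u q : lpair u (list_of q) = tpair u q.
Proof. by rewrite /lpair /lin big_map /tpair; under eq_bigr do rewrite mulrC. Qed.

Lemma coef_cat t1 t2 k : coef (t1 ++ t2) k = coef t1 k + coef t2 k.
Proof. exact: lin_cat. Qed.
Lemma coef_scale a t k : coef (tscale a t) k = a * coef t k.
Proof. exact: lin_scale. Qed.
Lemma coef_conj t k : coef (tconj t) k = (coef t (- k))^*.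
Proof.
rewrite /coef lin_conj; congr (_ ^*); apply: lin_ext => l.
by rewrite rmorph_nat eqr_oppLR.
Qed.
Lemma coef_weight w t k : coef (tweight w t) k = w k * coef t k.
Proof.
rewrite /coef lin_weight -linMl; apply: lin_ext => l.
by case: eqP => [->|]; rewrite ?mulr0.
Qed.

Lemma trealpart_real t : Defs.hermitian (coef (trealpart t)).
Proof.
move=> k; rewrite /trealpart !coef_scale !coef_cat !coef_conj opprK.
by apply: complex_eqP; rewrite !(cReJ, cImJ, cReMl, cImMl, cReD, cImD); lra.
Qed.
Lemma coef_real t : Defs.hermitian (coef t) -> coef (trealpart t) =1 coef t.
Proof.
move=> ht k; rewrite /trealpart coef_scale coef_cat coef_conj ht conjcK.
by apply: complex_eqP; rewrite !(cReMl, cImMl, cReD, cImD); lra.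
Qed.

Lemma ev_conj t x : ev (tconj t) x = (ev t x)^*.
Proof.
rewrite /ev lin_conj; congr (_ ^*); apply: lin_ext => k.
by rewrite dotpNr cexpiN conjcK.
Qed.
Lemma ev_cat t1 t2 x : ev (t1 ++ t2) x = ev t1 x + ev t2 x.
Proof. exact: lin_cat. Qed.
Lemma ev_scale a t x : ev (tscale a t) x = a * ev t x.
Proof. exact: lin_scale. Qed.
Lemma ev_mul t1 t2 x : ev (tmul t1 t2) x = ev t1 x * ev t2 x.
Proof.
rewrite /ev lin_mul -linMr; apply: lin_ext => k; rewrite -linMl.
by apply: lin_ext => l; rewrite dotpDr cexpiD.
Qed.
Lemma half_twice (a : R) : 2^-1 * (a + a) = a.
Proof. by lra. Qed.
Lemma Re_ev_realpart t x : complex.Re (ev (trealpart t) x) = complex.Re (ev t x).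
Proof. by rewrite /trealpart ev_scale ev_cat ev_conj cReMl cReD cReJ half_twice. Qed.
Lemma Im_ev_realpart t x : complex.Im (ev (trealpart t) x) = 0.
Proof. by rewrite /trealpart ev_scale ev_cat ev_conj cImMl cImD cImJ subrr mulr0. Qed.
Lemma Im_ev_real t x : Defs.hermitian (coef t) -> complex.Im (ev t x) = 0.
Proof.
move=> ht; rewrite -(Im_ev_realpart t x); congr complex.Im; rewrite /ev.
by apply: lin_coef_eq => k; rewrite coef_real.
Qed.

Lemma pair_cat u t1 t2 : lpair u (t1 ++ t2) = lpair u t1 + lpair u t2.
Proof. by rewrite /lpair lin_cat cReD. Qed.
Lemma pair_scale u (a : R) t : lpair u (tscale a%:C t) = a * lpair u t.
Proof. by rewrite /lpair lin_scale cReMl. Qed.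
Lemma pair_realpart u t : Defs.hermitian u -> lpair u (trealpart t) = lpair u t.
Proof.
move=> hu; rewrite /lpair /trealpart lin_scale lin_cat lin_conj cReMl cReD cReJ.
under [in X in _ + complex.Re X]lin_ext => k.
  by rewrite opprK -hu; over.
exact: half_twice.
Qed.
(** Multiplication by [phi] is its own adjoint for this bilinear pairing, so bounds on multiples of
    a measure become bounds on products of test polynomials. *)
Lemma pair_act phi u t : lpair (act phi u) t = lpair u (tmul phi t).
Proof.
rewrite /lpair /act lin_mul; congr complex.Re.
rewrite /lin; under eq_bigr => p _ do rewrite mulr_sumr.
rewrite exchange_big; apply: eq_bigr => q _ /=; rewrite mulr_sumr.
by apply: eq_bigr => p _; rewrite mulrCA opprD addrC.
Qed.
End Lists.

(** * Fejer means *)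

Section RealSequences.
Variable R : realType.
Implicit Types (a b : nat -> R) (l : R).

Lemma cvg_seqP a l : (a @ \oo --> l) <->
  (forall e : R, 0 < e -> exists N : nat, forall n, (N <= n)%N -> `|a n - l| <= e).
Proof.
split=> [/cvgrPdist_le H e e0|H].
  have [N _ HN] := H e e0; exists N => n Nn; rewrite distrC; exact: HN.
apply/cvgrPdist_le => e e0; have [N HN] := H e e0.
by exists N => // n /= Nn; rewrite distrC; exact: HN.
Qed.

Lemma cauchy_seq_cvg a :
  (forall e : R, 0 < e -> exists N : nat, forall n m, (N <= n)%N -> (N <= m)%N ->
     `|a n - a m| <= e) ->
  exists l, a @ \oo --> l.
Proof.
move=> H; suff : cvg (a @ \oo) by move=> h; exists (lim (a @ \oo)).
apply: R_complete; apply: cauchy_exP => e e0.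
have [N HN] := H (e / 2) (divr_gt0 e0 (ltr0Sn R 1)).
exists (a N); exists N => // n /= Nn; rewrite /ball /=.
by apply: le_lt_trans (HN _ _ (leqnn _) Nn) _; lra.
Qed.

End RealSequences.

Section Fejer.
Variable (R : realType).

Lemma cexpi2pi : cexpi (2 * pi : R) = 1.
Proof. by rewrite /cexpi mulr_natl cos2pi sin2pi. Qed.

(** The real part is 1 - 2 sin^2 t, and sin t > 0 on this interval. *)
Lemma cexpi_neq1 (t : R) : 0 < t < pi -> cexpi (2 * t) != 1.
Proof.
move=> t0; apply/negP => /eqP /(congr1 (@complex.Re R)).
rewrite /cexpi /= mulr_natl mulr2n cosD -!expr2 => h.
have := sin_gt0_pi t0; have := cos2Dsin2 t.
move: h; set c := cos t; set s := sin t => *; nra.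
Qed.

(** A geometric sum whose ratio w satisfies w^n = 1 and w != 1. *)
Lemma grid_sum_nat (n m : nat) : (0 < m < n)%N ->
  \sum_(s < n) cexpi (m%:R * (2 * pi * s%:R / n%:R) : R) = 0.
Proof.
move=> /andP[m0 mn]; pose w := cexpi (2 * (pi * m%:R / n%:R) : R).
have nn0 : (0 < n)%N by apply: leq_trans mn.
have n0 : (0 < n%:R :> R) by rewrite ltr0n.
rewrite (eq_bigr (fun s : 'I_n => w ^+ s)); last first.
  by move=> s _; rewrite /w -cexpiMn; congr cexpi; field; rewrite gt_eqF.
have w1 : w - 1 != 0.
  rewrite subr_eq0; apply: cexpi_neq1; rewrite divr_gt0 ?mulr_gt0 ?pi_gt0 ?ltr0n //=.
  by rewrite ltr_pdivrMr // ltr_pM2l ?pi_gt0 // ltr_nat.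
apply: (mulfI w1); rewrite mulr0 -subrX1 /w -cexpiMn.
rewrite (_ : _ * _ = m%:R * (2 * pi)); last by field; rewrite gt_eqF.
by rewrite cexpiMn cexpi2pi expr1n subrr.
Qed.

Lemma grid_sum (n : nat) (m : int) : (`|m| < n)%N ->
  \sum_(s < n) cexpi (m%:~R * (2 * pi * s%:R / n%:R) : R) = (m == 0)%:R * n%:R.
Proof.
case: m => [[|m]|m] /= mn.
- rewrite (eq_bigr (fun=> 1)) => [|s _]; last by rewrite mul0r cexpi0.
  by rewrite sumr_const card_ord mul1r.
- by rewrite mul0r grid_sum_nat.
rewrite mul0r; transitivity ((\sum_(s < n) cexpi (m.+1%:R * (2 * pi * s%:R / n%:R) : R))^*).
  rewrite rmorph_sum; apply: eq_bigr => s _ /=; rewrite NegzE mulrNz mulNr.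
  exact: cexpiN.
by rewrite grid_sum_nat // conjc0.
Qed.

(* Fourier coefficients of the one-dimensional Fejer kernel of order [N];
   the subtraction is truncated. *)
Definition fejer_weight (N : nat) (m : int) : R := (N.+1 - `|m|)%:R / N.+1%:R.

Lemma count_lt (n k : nat) : (\sum_(a < n) (a < k) = minn n k)%N.
Proof.
elim: n => [|n IH]; first by rewrite big_ord0 min0n.
by rewrite big_ord_recr /= IH; lia.
Qed.

Lemma count_diff_nat (n p : nat) :
  (\sum_(a < n) \sum_(b < n) ((b : nat) == a + p) = n - p)%N.
Proof.
rewrite (eq_bigr (fun a : 'I_n => ((a < n - p)%N : nat))).
  by rewrite count_lt; lia.
move=> a _; have [ap|ap] := ltnP (a + p) n.
  rewrite (bigD1 (Ordinal ap)) //= eqxx big1; first by lia.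
  by move=> b; rewrite -val_eqE /= => /negbTE ->.
rewrite big1; first by lia.
by move=> b _; have := ltn_ord b; case: eqP => //; lia.
Qed.

(** The autocorrelation of the indicator of {0, ..., n-1} is a triangle; this is the origin of the
    Fejer weights. *)
Lemma count_diff (n : nat) (m : int) :
  (\sum_(a < n) \sum_(b < n) ((a%:Z - b%:Z + m)%R == 0 :> int) = n - `|m|)%N.
Proof.
case: m => p /=.
  rewrite -count_diff_nat; apply: eq_bigr => a _; apply: eq_bigr => b _.
  by congr nat_of_bool; apply/eqP/eqP; lia.
rewrite -count_diff_nat exchange_big; apply: eq_bigr => a _; apply: eq_bigr => b _.
by congr nat_of_bool; apply/eqP/eqP; lia.
Qed.

(** The squared modulus of an exponential sum, so that nonnegativity is visible. *)
Definition fejer_kernel (N : nat) (y : R) : R :=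
  complex.Re ((\sum_(a < N.+1) cexpi (a%:R * y)) * (\sum_(a < N.+1) cexpi (a%:R * y))^*)
  / N.+1%:R.

Lemma fejer_kernel_ge0 N y : 0 <= fejer_kernel N y.
Proof.
rewrite /fejer_kernel divr_ge0 // cReM cReJ cImJ mulrN opprK.
by rewrite -!expr2 addr_ge0 // sqr_ge0.
Qed.

Lemma fejer_kernelE N y : (fejer_kernel N y)%:C =
  (N.+1%:R^-1)%:C * \sum_(a < N.+1) \sum_(b < N.+1) cexpi ((a%:Z - b%:Z)%:~R * y).
Proof.
rewrite /fejer_kernel; set D := \sum_(_ < _) _.
have -> : \sum_(a < N.+1) \sum_(b < N.+1) cexpi ((a%:Z - b%:Z)%:~R * y) = D * D^*.
  rewrite /D rmorph_sum mulr_suml; apply: eq_bigr => a _.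
  rewrite mulr_sumr; apply: eq_bigr => b _ /=.
  by rewrite intrB mulrBl cexpiD cexpiN.
apply: complex_eqP; rewrite ?cReMl ?cImMl; first by rewrite /= mulrC.
by rewrite cImM cReJ cImJ /= mulrN [complex.Im D * _]mulrC addNr mulr0.
Qed.

(** The integrand has frequencies a - b + m with |a - b| <= N, all smaller than n in absolute value,
    so the grid sum is exact and counts the pairs with a - b + m = 0. *)
Lemma fejer_quadrature (N n : nat) (m : int) : (`|m| + N < n)%N ->
  (n%:R^-1)%:C * \sum_(s < n) (fejer_kernel N (2 * pi * s%:R / n%:R))%:C
     * cexpi (m%:~R * (2 * pi * s%:R / n%:R) : R) = (fejer_weight N m)%:C.
Proof.
move=> mn; have n0 : (n%:R != 0 :> R) by rewrite pnatr_eq0; lia.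
rewrite (_ : \sum_(s < n) _ = (N.+1%:R^-1)%:C * \sum_(a < N.+1) \sum_(b < N.+1)
   ((a%:Z - b%:Z + m == 0)%:R * n%:R)); last first.
  transitivity ((N.+1%:R^-1)%:C * \sum_(s < n) \sum_(a < N.+1) \sum_(b < N.+1)
      cexpi ((a%:Z - b%:Z + m)%:~R * (2 * pi * s%:R / n%:R) : R)).
    rewrite mulr_sumr; apply: eq_bigr => s _; rewrite fejer_kernelE -mulrA; congr (_ * _).
    rewrite mulr_suml; apply: eq_bigr => a _; rewrite mulr_suml; apply: eq_bigr => b _.
    by rewrite [X in _ = cexpi (X * _)]intrD [X in _ = cexpi X]mulrDl [RHS]cexpiD.
  congr (_ * _); rewrite exchange_big; apply: eq_bigr => a _.
  rewrite exchange_big; apply: eq_bigr => b _; rewrite grid_sum //.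
  by have := ltn_ord a; have := ltn_ord b; lia.
under eq_bigr => a _ do rewrite -mulr_suml -natr_sum.
rewrite -mulr_suml -natr_sum count_diff /fejer_weight.
rewrite -!(rmorph_nat (real_complex R)) -!rmorphM /=; congr (_%:C).
by rewrite (natrM _ (N.+1 - `|m|) n); field; rewrite n0 nat1r pnatr_eq0.
Qed.

Variable d : nat.
Notation Z := (Zd d).
Implicit Types (t : tlist R d).

Lemma lin_ext_in (G1 G2 : Z -> R[i]) t :
  (forall k, k \in unzip1 t -> G1 k = G2 k) -> lin G1 t = lin G2 t.
Proof.
move=> H; rewrite /lin big_seq [RHS]big_seq; apply: eq_bigr => p pt.
by rewrite H // map_f.
Qed.

(* The multiplier is an average of translates against the nonnegative Fejer kernel,
   over a grid of [n]-th roots of unity fine enough to avoid aliasing. *)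
Lemma fejer_coord_contraction N (j : 'I_d) t (c : R) :
  (forall x, `|complex.Re (ev t x)| <= c) ->
  forall x, `|complex.Re (ev (tweight (fun k => (fejer_weight N (k j))%:C) t) x)| <= c.
Proof.
(* The sum dominates every |k j| occurring in [t]; the added N and the successor give the strict
   bound required by the quadrature. *)
move=> H x; pose n := (\sum_(p <- t) `|p.1 j| + N).+1.
pose y (s : nat) : R := 2 * pi * s%:R / n%:R.
pose xs (s : nat) : Td R d := fun i => x i + (if i == j then y s else 0).
have dot s k : dotp (xs s) k = dotp x k + (k j)%:~R * y s.
  rewrite /xs dotpDl; congr (_ + _); rewrite /dotp (bigD1 j) //= eqxx big1.
    by rewrite addr0 mulrC.
  by move=> i /negbTE ->; rewrite mul0r.
have -> : ev (tweight (fun k => (fejer_weight N (k j))%:C) t) x =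
   (n%:R^-1)%:C * \sum_(s < n) (fejer_kernel N (y s))%:C * ev t (xs s).
  rewrite /ev lin_weight.
  transitivity (lin (fun k => (n%:R^-1)%:C * \sum_(s < n) (fejer_kernel N (y s))%:C *
     cexpi (dotp (xs s) k)) t); last first.
    rewrite linMl lin_sum; congr (_ * _); apply: eq_bigr => s _.
    by rewrite linMl.
  apply: lin_ext_in => k kt; rewrite -(@fejer_quadrature N n); last first.
    rewrite /n ltnS leq_add2r; case/mapP: kt => p pt ->.
    by rewrite (big_rem p) //= leq_addr.
  rewrite -mulrA mulr_suml; congr (_ * _); apply: eq_bigr => s _.
  by rewrite dot cexpiD -mulrA [cexpi (_ * _) * _]mulrC.
have n0 : 0 < n%:R^-1 :> R by rewrite invr_gt0 ltr0n.
rewrite cReMl cRe_sum normrM gtr0_norm //.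
(* Total mass one is the quadrature identity at frequency 0. *)
have tot : n%:R^-1 * \sum_(s < n) fejer_kernel N (y s) = 1.
  have Nn : (`|0 : int| + N < n)%N by rewrite /n ltnS leq_addl.
  have /(congr1 (@complex.Re R)) := fejer_quadrature Nn.
  rewrite cReMl cRe_sum /fejer_weight subn0 divff ?pnatr_eq0 // => e.
  apply: eq_trans (e : _ = 1); congr (_ * _); apply: eq_bigr => s _.
  by rewrite mul0r cexpi0 mulr1.
rewrite -[leRHS]mul1r -[X in _ <= X * _]tot -mulrA ler_pM2l //.
apply: le_trans (ler_norm_sum _ _ _) _; rewrite mulr_suml.
apply: ler_sum => s _; rewrite cReMl normrM ger0_norm ?fejer_kernel_ge0 //.
by rewrite ler_wpM2l ?fejer_kernel_ge0.
Qed.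

Definition fejer_mult (N : nat) (k : Z) : R := \prod_(j < d) fejer_weight N (k j).

(** The multiplier is a product over coordinates, applied one coordinate at a time by induction on
    the list of coordinates. *)
Lemma fejer_contraction N t (c : R) :
  (forall x, `|complex.Re (ev t x)| <= c) ->
  forall x, `|complex.Re (ev (tweight (fun k => (fejer_mult N k)%:C) t) x)| <= c.
Proof.
move=> H; rewrite /fejer_mult; elim: (index_enum _) => [|j r IH] x.
  rewrite (_ : ev _ x = ev t x) // /ev lin_weight; apply: lin_ext => k.
  by rewrite big_nil mul1r.
have := fejer_coord_contraction N j IH x; congr (`|complex.Re _| <= c).
rewrite /ev !lin_weight; apply: lin_ext => k.
by rewrite big_cons real_complexM mulrCA mulrA.
Qed.

Lemma box_uniq N : uniq (box d N).
Proof.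
rewrite map_inj_uniq ?enum_uniq // => s t /ffunP st; apply/ffunP => j.
by have := st j; rewrite !ffunE => /addIr[]; exact: val_inj.
Qed.

Lemma mem_box N (k : Z) : (k \in box d N) = [forall j, `|k j| <= N]%N.
Proof.
apply/mapP/forallP => [[t _ ->] j|H].
  by rewrite ffunE; move: (t j) => [a /= aN]; lia.
exists [ffun j => inord `|(k j + N%:Z)%R|%N]; first by rewrite mem_enum.
apply/ffunP => j; rewrite !ffunE; have := H j; move: (k j) => a aN.
by rewrite inordK; lia.
Qed.

(** The truncated subtraction makes [fejer_mult] vanish off the box, so a sum over [box] becomes a
    multiplier acting on all frequencies. *)
Lemma fejer_multE N (k : Z) :
  (fejer_mult N k)%:C = (k \in box d N)%:R * (fejer R N k)%:C.
Proof.
rewrite mem_box /fejer_mult /fejer; case: forallP => H.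
  rewrite mul1r; congr (_%:C); apply: eq_bigr => j _.
  rewrite /fejer_weight natrB; last by apply: leqW; exact: H.
  by rewrite mulrBl divff ?pnatr_eq0.
have /forallPn[j jN] : ~~ [forall j, `|k j| <= N]%N by apply/forallP.
rewrite mul0r (bigD1 j) //= /fejer_weight (_ : (N.+1 - _)%N = 0%N); last by lia.
by rewrite mul0r mul0r.
Qed.

Definition fmean (N : nat) (u v : Z -> R[i]) : R :=
  complex.Re (\sum_(k <- box d N) (fejer R N k)%:C * u k * v (- k)).

Lemma fmean_coef N t v : fmean N (coef t) v = lpair v (tweight (fun k => (fejer_mult N k)%:C) t).
Proof.
rewrite /fmean /lpair lin_weight; congr complex.Re.
rewrite (eq_bigr (fun k => coef t k * ((fejer R N k)%:C * v (- k)))).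
  rewrite sum_coef ?box_uniq //; apply: lin_ext => k.
  by rewrite fejer_multE mulrA.
by move=> k _; rewrite mulrA; congr (_ * _); rewrite mulrC.
Qed.

Lemma fejer_weight_cvg m : (fun N => fejer_weight N m) @ \oo --> (1 : R).
Proof.
have : (fun N => 1 - (`|m|%N)%:R * harmonic N) @ \oo --> (1 - (`|m|%N)%:R * 0 : R).
  by apply: cvgB; [exact: cvg_cst|apply: cvgMl_tmp; exact: cvg_harmonic].
rewrite mulr0 subr0; apply: cvg_trans; apply: near_eq_cvg.
exists `|m|%N => // N /= mN; rewrite /fejer_weight natrB; last by apply: leqW.
by rewrite mulrBl divff ?pnatr_eq0.
Qed.

Lemma fmean_coef_cvg t v : (fun N => fmean N (coef t) v) @ \oo --> lpair v t.
Proof.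
have -> : (fun N => fmean N (coef t) v) =
  (fun N => \sum_(p <- t) fejer_mult N p.1 * complex.Re (p.2 * v (- p.1))).
  apply/funext => N; rewrite fmean_coef /lpair lin_weight /lin cRe_sum.
  by apply: eq_bigr => p _; rewrite mulrCA cReMl.
have -> : lpair v t = \sum_(p <- t) 1 * complex.Re (p.2 * v (- p.1)).
  by rewrite /lpair /lin cRe_sum; apply: eq_bigr => p _; rewrite mul1r.
apply: cvg_big => [|p _]; first exact: add_continuous.
apply: cvgMr_tmp; have -> : (1 : R) = \prod_(j < d) 1 by rewrite big1.
apply: cvg_big => [|j _]; [exact: mul_continuous|exact: fejer_weight_cvg].
Qed.

End Fejer.

(** * Total variation and the duality pairing *)

Section TotalVariation.
Variables (R : realType) (d : nat).
Notation Z := (Zd d).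
Implicit Types (t : tlist R d) (u v f g : Z -> R[i]).

(* [v], viewed as a functional on trigonometric polynomials, has norm at most [A] *)
Definition tvb v (A : R) : Prop := forall t (c : R),
  (forall x, `|complex.Re (ev t x)| <= c) -> `|lpair v t| <= A * c.

Lemma tvb_ge0 v A : tvb v A -> 0 <= A.
Proof.
move=> H; have h : `|lpair v [::]| <= A * 1.
  by apply: H => x; rewrite /ev /lin big_nil normr0.
by rewrite mulr1 in h; exact: le_trans (normr_ge0 _) h.
Qed.

Lemma tvbW v A B : A <= B -> tvb v A -> tvb v B.
Proof.
move=> AB H t c tc; apply: le_trans (H _ _ tc) _; apply: ler_wpM2r => //.
exact: le_trans (normr_ge0 _) (tc (fun=> 0)).
Qed.

(** [TVnorm] tests real polynomials bounded by 1, [tvb] all lists with any bound c. Taking real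
    parts removes the first restriction and rescaling the second, by c + e because c may be 0. *)
Lemma tvbP v A : Defs.hermitian v -> (TVnorm v <= A%:E)%E <-> tvb v A.
Proof.
move=> hv; split=> [H t c tc|H].
  have c0 : 0 <= c by exact: le_trans (normr_ge0 _) (tc (fun=> 0)).
  have key e : 0 < e -> `|lpair v t| <= A * (c + e).
    move=> e0; have ce : 0 < c + e by apply: ltr_wpDl.
    pose t' := tscale ((c + e)^-1)%:C (trealpart t).
    have : ((`|tpair v (trig_of t')|)%:E <= A%:E)%E.
      apply: le_trans H; apply: ereal_sup_ubound; exists (trig_of t') => //; split.
        move=> k; rewrite !tcoef_trig_of !(coef_scale _ (trealpart t)) trealpart_real.
        by apply: complex_eqP; rewrite !(cReJ, cImJ, cReMl, cImMl); lra.
      move=> x; rewrite teval_trig_of ev_scale cReMl Re_ev_realpart normrM.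
      rewrite gtr0_norm ?invr_gt0 // mulrC ler_pdivrMr // mul1r.
      by apply: le_trans (tc x) _; rewrite lerDl ltW.
    rewrite lee_fin tpair_trig_of pair_scale pair_realpart // normrM.
    by rewrite gtr0_norm ?invr_gt0 // mulrC ler_pdivrMr.
  have A0 : 0 <= A.
    have := le_trans (normr_ge0 _) (key 1 ltr01).
    by rewrite pmulr_lge0 //; apply: ltr_wpDl.
  apply/ler_addgt0Pr => e e0; have A1 : 0 < A + 1 by apply: ltr_wpDl.
  apply: le_trans (key (e / (A + 1)) (divr_gt0 e0 A1)) _.
  rewrite mulrDr lerD2l mulrA ler_pdivrMr // mulrC ler_pM2l //; lra.
apply: ge_ereal_sup => _ [q [rq qb] <-]; rewrite lee_fin -pair_list_of.
by rewrite -[A]mulr1; apply: H => x; rewrite ev_list_of.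
Qed.

Lemma tvb_coef_Re v A k : tvb v A -> `|complex.Re (v k)| <= A.
Proof.
move=> /(_ [:: (- k, 1)] 1); rewrite mulr1 /lpair /lin big_seq1 /= mul1r opprK; apply.
move=> x; rewrite /ev /lin big_seq1 cReM /= mul1r mul0r subr0.
rewrite ler_norml cos_le1 andbT; exact: cos_geN1.
Qed.

(** The test polynomial is -i e_{-k}: the factor -i makes the pairing read off the imaginary part of
    [v k], and the real part of the polynomial is a sine. *)
Lemma tvb_coef_Im v A k : tvb v A -> `|complex.Im (v k)| <= A.
Proof.
move=> /(_ [:: (- k, 0 +i* (-1))] 1); rewrite mulr1 /lpair /lin big_seq1 /= opprK cReM /=.
rewrite mul0r sub0r mulN1r opprK; apply.
move=> x; rewrite /ev /lin big_seq1 /= mul0r sub0r mulN1r opprK.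
rewrite ler_norml sin_le1 andbT; exact: sin_geN1.
Qed.

Lemma pair_lin (a b : R) v1 v2 t :
  lpair (fun k => a%:C * v1 k + b%:C * v2 k) t = a * lpair v1 t + b * lpair v2 t.
Proof.
rewrite /lpair -!cReMl -cReD; congr complex.Re; rewrite /lin !mulr_sumr -big_split.
by apply: eq_bigr => p _; rewrite mulrDr !(mulrCA p.2).
Qed.

Lemma tvb_lin (a b : R) v1 v2 A1 A2 : tvb v1 A1 -> tvb v2 A2 ->
  tvb (fun k => a%:C * v1 k + b%:C * v2 k) (`|a| * A1 + `|b| * A2).
Proof.
move=> H1 H2 t c tc; rewrite pair_lin; apply: le_trans (ler_normD _ _) _.
rewrite !normrM mulrDl -!mulrA; apply: lerD; apply: ler_wpM2l => //.
  exact: H1.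
exact: H2.
Qed.

Lemma tvb_act phi v A b : Defs.hermitian (coef phi) ->
  (forall x, `|complex.Re (ev phi x)| <= b) -> tvb v A -> tvb (act phi v) (A * b).
Proof.
move=> rphi phib H t c tc; rewrite pair_act -mulrA; apply: H => x.
rewrite ev_mul cReM Im_ev_real // mul0r subr0 normrM.
by apply: ler_pM.
Qed.

Lemma ev_bounded t : exists2 b, 0 < b & forall x, `|complex.Re (ev t x)| <= b.
Proof.
exists (1 + \sum_(p <- t) (`|complex.Re p.2| + `|complex.Im p.2|)) => [|x].
  by rewrite ltr_pwDl // sumr_ge0 // => p _; rewrite addr_ge0.
rewrite /ev /lin cRe_sum; apply: le_trans (ler_norm_sum _ _ _) _.
rewrite -[leLHS]add0r lerD //; apply: ler_sum => p _.
rewrite cReM /=; apply: le_trans (ler_normB _ _) _; rewrite !normrM.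
apply: lerD; apply: ler_piMr => //; rewrite ler_norml.
  by rewrite cos_le1 cos_geN1.
by rewrite sin_le1 sin_geN1.
Qed.

(** The sequence is that of normalized Lebesgue measure. Pairing with it takes the mean value, which
    is the Fejer mean of order 0, hence a contraction. *)
Lemma tvb_unit : tvb (fun k : Z => (k == 0)%:R) 1.
Proof.
move=> t c tc; rewrite mul1r; have := fejer_contraction 0 tc (fun=> 0).
congr (`|_| <= c); congr complex.Re; rewrite /ev lin_weight.
apply: lin_ext => k; rewrite (_ : dotp _ _ = 0); last first.
  by rewrite /dotp big1 // => j _; rewrite mul0r.
rewrite cexpi0 mulr1 fejer_multE oppr_eq0 mem_box; case: eqP => [->|k0].
  rewrite (_ : [forall j, _]); last by apply/forallP => j; rewrite ffunE.
  rewrite mul1r /fejer big1 // => j _; rewrite ffunE.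
  by rewrite mul0r subr0.
case: forallP => H; last by rewrite mul0r.
by case: k0; apply/ffunP => j; have := H j; rewrite ffunE leqn0 absz_eq0 => /eqP.
Qed.

(** A trigonometric polynomial is a density against Lebesgue measure, that is, [act t] of the unit
    sequence. *)
Lemma tvb_trig t : Defs.hermitian (coef t) -> exists A, tvb (coef t) A.
Proof.
move=> rt; have [b b0 tb] := ev_bounded t.
exists (1 * b); have := tvb_act rt tb tvb_unit; congr tvb; apply/funext => k.
by apply: lin_ext => l; rewrite subr_eq0 eq_sym.
Qed.

Lemma fmeanB N t1 t2 v : fmean N (coef t1) v - fmean N (coef t2) v =
  fmean N (coef (t1 ++ tscale (-1)%:C t2)) v.
Proof.
have cw (w : Z -> R[i]) : lpair v (tweight w (t1 ++ tscale (-1)%:C t2)) =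
    lpair v (tweight w t1) - lpair v (tweight w t2).
  by rewrite /lpair !lin_weight lin_cat lin_scale cReD cReMl mulN1r.
by rewrite !fmean_coef cw.
Qed.

(** For fixed N the mean sees finitely many coefficients, so it is the limit of the means of the
    polynomials [q n], which by contraction stay within A e of that of [q n0]. Uniformity in N
    permits the later limit in N, uniformity in v the topological arguments. *)
Lemma fejer_approx u (e : R) : is_cont u -> 0 < e ->
  exists t, forall N v A, tvb v A -> `|fmean N u v - fmean N (coef t) v| <= A * e.
Proof.
move=> [q [rq [qC [qRe qIm]]]] e0; have [n0 Hn0] := qC e e0.
exists (list_of (q n0)) => N v A vA.
have lim : (fun n => fmean N (coef (list_of (q n))) v) @ \oo --> fmean N u v.
  have E w : fmean N w v = \sum_(k <- box d N) fejer R N k *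
      (complex.Re (w k) * complex.Re (v (- k)) - complex.Im (w k) * complex.Im (v (- k))).
    by rewrite /fmean cRe_sum; apply: eq_bigr => k _; rewrite -mulrA cReMl cReM.
  rewrite E; under eq_fun => n do rewrite E.
  apply: cvg_big => [|k _]; first exact: add_continuous.
  apply: cvgMl_tmp; apply: cvgB; apply: cvgMr_tmp.
    by under eq_fun => n do rewrite coef_list_of; exact: qRe.
  by under eq_fun => n do rewrite coef_list_of; exact: qIm.
apply/ler_addgt0Pr => e' e'0.
have [n1 Hn1] := (cvg_seqP _ _).1 lim e' e'0.
pose n := maxn n0 n1.
have := Hn1 n (leq_maxr _ _).
have : `|fmean N (coef (list_of (q n))) v - fmean N (coef (list_of (q n0))) v| <= A * e.
  rewrite fmeanB fmean_coef; apply: vA; apply: fejer_contraction => x.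
  rewrite ev_cat ev_scale cReD cReMl mulN1r !ev_list_of.
  by apply: Hn0 => //; exact: leq_maxl.
set a := fmean _ _ _; set b := fmean _ _ _; set c := fmean _ _ _ => h1 h2.
have -> : c - b = (c - a) + (a - b) by ring.
by apply: le_trans (ler_normD _ _) _; rewrite addrC lerD // distrC.
Qed.

End TotalVariation.

Section Pairing.
Variables (R : realType) (d : nat) (Lh : Zd d -> R[i]) (s : seq (Zd d)).
Notation Z := (Zd d).
Implicit Types (t : tlist R d) (u v f g : Z -> R[i]).
Hypothesis hLh : Defs.hermitian Lh.
Hypothesis sP : forall k, (k \in s) = (Lh k == 0).

Definition null_part g : tlist R d := list_of (Trig s g).

Lemma coef_null_part g k : coef (null_part g) k = if Lh k == 0 then g k else 0.
Proof. by rewrite coef_list_of /tcoef /= sP. Qed.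

(** Off the null frequencies Lh (- k) is the conjugate of Lh k, so its product with the conjugate of
    [Ldag Lh k] is 1 and L can be moved onto f. *)
Lemma fmean_split N g f : fmean N g f =
  fmean N (fun k => (Ldag Lh k)^* * g k) (Lapp Lh f) + fmean N (coef (null_part g)) f.
Proof.
rewrite /fmean -cReD -big_split; congr complex.Re; apply: eq_bigr => k _ /=.
rewrite coef_null_part /Lapp /Ldag hLh num_conjE; case: eqP => [->|/eqP k0].
  by rewrite conjc0 !(mul0r, mulr0) add0r.
rewrite mulr0 mul0r addr0 conjc_inv; field.
by rewrite conjc_eq0.
Qed.

(** [wpair] is a [limn], meaningful only once the means converge. They converge for polynomials, and
    uniform approximation makes the general sequence Cauchy. *)
Lemma wpair_cvg g f A : CL Lh g -> tvb (Lapp Lh f) A ->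
  (fun N => fmean N g f) @ \oo --> wpair g f.
Proof.
move=> [_ cg] fA.
suff [l hl] : exists l : R, (fun N => fmean N g f) @ \oo --> l.
  suff -> : wpair g f = l by [].
  by apply: cvg_lim => //; exact: hl.
have A0 := tvb_ge0 fA; have A1 : 0 < A + 1 by apply: ltr_wpDl.
have [l1 hl1] : exists l : R, (fun N => fmean N (fun k => (Ldag Lh k)^* * g k) (Lapp Lh f)) @ \oo --> l.
  apply: cauchy_seq_cvg => e e0.
  (* Four errors add up: approximation and convergence, at n and at m. Since A may be 0, the
     division is by A + 1. *)
  have e3 : 0 < e / 4 by rewrite divr_gt0.
  have [t Ht] := fejer_approx cg (divr_gt0 e3 A1).
  have [N0 HN0] := (cvg_seqP _ _).1 (@fmean_coef_cvg _ _ t (Lapp Lh f)) (e / 4) e3.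
  have small : A * (e / 4 / (A + 1)) <= e / 4.
    by rewrite mulrA ler_pdivrMr // mulrC ler_pM2l //; lra.
  exists N0 => n m Nn Nm.
  have := HN0 n Nn; have := HN0 m Nm.
  have := le_trans (Ht n _ _ fA) small; have := le_trans (Ht m _ _ fA) small.
  by rewrite !ler_norml => /andP[? ?] /andP[? ?] /andP[? ?] /andP[? ?]; apply/andP; lra.
exists (l1 + lpair f (null_part g)); under eq_fun => N do rewrite fmean_split.
by apply: cvgD => //; exact: fmean_coef_cvg.
Qed.

Lemma wpair_approx g (e : R) : CL Lh g -> 0 < e ->
  exists t, forall f A, tvb (Lapp Lh f) A -> `|wpair g f - lpair f t| <= A * e.
Proof.
move=> gL e0; have [t Ht] := fejer_approx gL.2 e0.
(* The weight Lh (- k) turns the pairing of [t] with L f into a pairing with f; the null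
   frequencies, invisible to L, are added exactly. *)
exists (tweight (fun k => Lh (- k)) t ++ null_part g) => f A fA.
have lim : (fun N => fmean N g f - fmean N (coef t) (Lapp Lh f) -
    fmean N (coef (null_part g)) f) @ \oo -->
    wpair g f - lpair (Lapp Lh f) t - lpair f (null_part g).
  by apply: cvgB; [apply: cvgB; [exact: wpair_cvg fA|]|]; exact: fmean_coef_cvg.
have -> : wpair g f - lpair f (tweight (fun k => Lh (- k)) t ++ null_part g) =
   wpair g f - lpair (Lapp Lh f) t - lpair f (null_part g).
  by rewrite pair_cat /lpair lin_weight opprD addrA.
apply/ler_addgt0Pr => e' e'0; have [N /(_ N (leqnn _))] := (cvg_seqP _ _).1 lim e' e'0.
have := Ht N _ _ fA; rewrite (fmean_split N g f).
by rewrite !ler_norml => /andP[? ?] /andP[? ?]; apply/andP; lra.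
Qed.

Lemma wpair_lin g f1 f2 A1 A2 (a b : R) : CL Lh g ->
  tvb (Lapp Lh f1) A1 -> tvb (Lapp Lh f2) A2 ->
  wpair g (fun k => a%:C * f1 k + b%:C * f2 k) = a * wpair g f1 + b * wpair g f2.
Proof.
move=> gL h1 h2; apply: cvg_lim => //.
have E N : fmean N g (fun k => a%:C * f1 k + b%:C * f2 k) = a * fmean N g f1 + b * fmean N g f2.
  rewrite /fmean -!cReMl -cReD; congr complex.Re; rewrite !mulr_sumr -big_split.
  by apply: eq_bigr => k _ /=; ring.
rewrite -[X in X @ _ --> _](_ : (fun N => a * fmean N g f1 + b * fmean N g f2) = _).
  by apply: cvgD; apply: cvgMl_tmp; apply: wpair_cvg; eassumption.
by apply/funext => N; rewrite -E.
Qed.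

Lemma wpair_sum g n (f : 'I_n -> Z -> R[i]) (c : 'I_n -> R) : CL Lh g ->
  (forall i, exists A, tvb (Lapp Lh (f i)) A) ->
  wpair g (fun k => \sum_(i < n) (c i)%:C * f i k) = \sum_(i < n) c i * wpair g (f i).
Proof.
move=> gL h; apply: cvg_lim => //.
have E N : fmean N g (fun k => \sum_(i < n) (c i)%:C * f i k) = \sum_(i < n) c i * fmean N g (f i).
  rewrite /fmean (eq_bigr (fun k => \sum_(i < n) (c i)%:C * ((fejer R N k)%:C * g k * f i (- k)))).
    rewrite exchange_big cRe_sum; apply: eq_bigr => i _.
    by rewrite -mulr_sumr cReMl.
  by move=> k _; rewrite mulr_sumr; apply: eq_bigr => i _; rewrite mulrCA.
rewrite -[X in X @ _ --> _](_ : (fun N => \sum_(i < n) c i * fmean N g (f i)) = _).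
  apply: cvg_big => [|i _]; first exact: add_continuous.
  by have [A fA] := h i; apply: cvgMl_tmp; apply: wpair_cvg fA.
by apply/funext => N; rewrite -E.
Qed.

Lemma wpair_coef g t : wpair g (coef t) = lpair g t.
Proof.
(* Reflecting the frequencies moves the polynomial to the first slot of the pairing, where
   convergence of the means is known. *)
apply: cvg_lim => //; pose t' : tlist R d := [seq (- p.1, p.2) | p <- t].
have E N : fmean N g (coef t) = fmean N (coef t') (fun k => g (- k)).
  rewrite /fmean; congr complex.Re; apply: eq_bigr => k _; rewrite opprK mulrAC.
  congr (_ * _ * _); rewrite /t' /coef /lin big_map; apply: eq_bigr => p _ /=.
  by rewrite eqr_oppLR.
rewrite -[X in X @ _ --> _](_ : (fun N => fmean N (coef t') (fun k => g (- k))) = _); last first.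
  by apply/funext => N; rewrite -E.
have -> : lpair g t = lpair (fun k => g (- k)) t'.
  by rewrite /lpair /t' /lin big_map; under [in RHS]eq_bigr do rewrite /= opprK.
exact: fmean_coef_cvg.
Qed.

End Pairing.

(** * Hartley coordinates *)

Section Hartley.
Variables (R : realType) (d : nat).
Notation Z := (Zd d).
Implicit Types (t : tlist R d) (f : Z -> R[i]) (r : Z -> R).

(* The Hartley transform identifies real sequences with Hermitian ones. *)
Definition hart f : Z -> R := fun k => complex.Re (f k) + complex.Im (f k).
Definition unhart r : Z -> R[i] :=
  fun k => ((r k + r (- k)) / 2) +i* ((r k - r (- k)) / 2).

Lemma unhart_hermitian r : Defs.hermitian (unhart r).
Proof. by move=> k; apply: complex_eqP; rewrite ?cReJ ?cImJ /= opprK; lra. Qed.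
Lemma hartK f : Defs.hermitian f -> unhart (hart f) = f.
Proof.
move=> hf; apply/funext => k; rewrite /unhart /hart hf.
by apply: complex_eqP; rewrite ?cReJ ?cImJ /=; lra.
Qed.
Lemma unhartK r : hart (unhart r) = r.
Proof. by apply/funext => k; rewrite /hart /=; lra. Qed.

(** The l^1 modulus: real-valued, unlike the norm of [R[i]], yet still subadditive and
    submultiplicative. *)
Definition nc (z : R[i]) : R := `|complex.Re z| + `|complex.Im z|.

Lemma nc_ge0 z : 0 <= nc z. Proof. by rewrite addr_ge0. Qed.
Lemma nc_Re z : `|complex.Re z| <= nc z. Proof. by rewrite lerDl. Qed.
Lemma ncD z w : nc (z + w) <= nc z + nc w.
Proof.
rewrite /nc cReD cImD addrACA.
by rewrite lerD // ler_normD.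
Qed.
Lemma ncM z w : nc (z * w) <= nc z * nc w.
Proof.
rewrite /nc cReM cImM mulrDl !mulrDr -!normrM.
apply: le_trans (lerD (ler_normB _ _) (ler_normD _ _)) _.
by rewrite !normrM; lra.
Qed.
Lemma ncMl (a : R) z : nc (a%:C * z) = `|a| * nc z.
Proof. by rewrite /nc cReMl cImMl !normrM mulrDr. Qed.
Lemma nc_sum (I : Type) (s : seq I) (F : I -> R[i]) :
  nc (\sum_(i <- s) F i) <= \sum_(i <- s) nc (F i).
Proof.
elim/big_rec2: _ => [|i x y _ h]; first by rewrite /nc /= normr0 addr0.
by apply: le_trans (ncD _ _) _; rewrite lerD2l.
Qed.

Lemma norm_le_nc z : `|z| <= (nc z)%:C.
Proof.
rewrite normc_def lecR; have := sqr_ge0 (complex.Re z); have := sqr_ge0 (complex.Im z) => h1 h2.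
rewrite -[leRHS](@ger0_norm _ (nc z)) ?nc_ge0 // -sqrtr_sqr ler_wsqrtr //.
rewrite /nc sqrrD !real_normK ?num_real //.
have : 0 <= `|complex.Re z| * `|complex.Im z| by rewrite mulr_ge0.
by lra.
Qed.

Lemma nc_le_norm z (a : R) : `|z| <= a%:C -> nc z <= 2 * a.
Proof.
rewrite normc_def lecR => h; rewrite mulr_natl mulr2n.
by apply: lerD; apply: le_trans h; rewrite -sqrtr_sqr ler_wsqrtr // ?lerDl ?lerDr sqr_ge0.
Qed.

Lemma slow_growthP (c : Z -> R[i]) : slow_growth c <->
  exists (A : R) (N : nat), forall k, nc (c k) <= A * ((knorm k).+1)%:R ^+ N.
Proof.
split=> -[A [N H]].
  by exists (2 * A), N => k; rewrite -mulrA; exact: nc_le_norm.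
by exists A, N => k; apply: le_trans (norm_le_nc _) _; rewrite lecR.
Qed.

Lemma knorm_pow_ge1 (k : Z) N : 1 <= ((knorm k).+1)%:R ^+ N :> R.
Proof. by rewrite exprn_ege1 // ler1n. Qed.

Lemma slow_growth_lin (a b : R) (c1 c2 : Z -> R[i]) : slow_growth c1 -> slow_growth c2 ->
  slow_growth (fun k => a%:C * c1 k + b%:C * c2 k).
Proof.
move=> /slow_growthP[A1 [N1 H1]] /slow_growthP[A2 [N2 H2]].
apply/slow_growthP; exists (`|a| * `|A1| + `|b| * `|A2|), (N1 + N2)%N => k.
apply: le_trans (ncD _ _) _; rewrite !ncMl mulrDl -!mulrA.
have q1 := knorm_pow_ge1 k N1; have q2 := knorm_pow_ge1 k N2.
have p0 N : 0 <= ((knorm k).+1)%:R ^+ N :> R by rewrite exprn_ge0.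
rewrite exprD; apply: lerD; apply: ler_wpM2l => //.
  apply: le_trans (H1 k) (le_trans (ler_wpM2r (p0 N1) (ler_norm A1)) _).
  by rewrite ler_wpM2l // ler_peMr.
apply: le_trans (H2 k) (le_trans (ler_wpM2r (p0 N2) (ler_norm A2)) _).
by rewrite ler_wpM2l // ler_peMl.
Qed.

Lemma slow_growth_bounded (c : Z -> R[i]) (B : R) : (forall k, nc (c k) <= B) -> slow_growth c.
Proof. by move=> H; apply/slow_growthP; exists B, 0%N => k; rewrite expr0 mulr1. Qed.

Lemma hermitian_lin (a b : R) (c1 c2 : Z -> R[i]) : Defs.hermitian c1 -> Defs.hermitian c2 ->
  Defs.hermitian (fun k => a%:C * c1 k + b%:C * c2 k).
Proof.
move=> h1 h2 k; rewrite h1 h2.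
by apply: complex_eqP; rewrite !(cReJ, cImJ, cReD, cImD, cReMl, cImMl); lra.
Qed.

Lemma hermitianM (c1 c2 : Z -> R[i]) : Defs.hermitian c1 -> Defs.hermitian c2 ->
  Defs.hermitian (fun k => c1 k * c2 k).
Proof. by move=> h1 h2 k; rewrite h1 h2 -rmorphM. Qed.

Lemma pair_bound f t (b : Z -> R) : (forall k, nc (f k) <= b k) ->
  `|lpair f t| <= \sum_(p <- t) nc p.2 * b (- p.1).
Proof.
move=> H; apply: le_trans (nc_Re _) _; apply: le_trans (nc_sum _ _) _.
apply: ler_sum => p _; apply: le_trans (ncM _ _) _.
by rewrite ler_wpM2l ?nc_ge0.
Qed.

Lemma pair_unhart_cvg t (F : set_system (Z -> R)) r : Filter F ->
  (forall k, (fun r' : Z -> R => r' k) @ F --> r k) ->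
  (fun r' => lpair (unhart r') t) @ F --> lpair (unhart r) t.
Proof.
move=> FF pc.
elim: t => [|p t IH].
  rewrite (_ : (fun r' => _) = fun=> lpair (unhart r) [::]).
    exact: cvg_cst.
  by apply/funext => r'; rewrite /lpair /lin !big_nil.
have E (r' : Z -> R) : lpair (unhart r') (p :: t) =
    (complex.Re p.2 * ((r' (- p.1) + r' (- - p.1)) / 2)
     - complex.Im p.2 * ((r' (- p.1) - r' (- - p.1)) / 2)) + lpair (unhart r') t.
  by rewrite /lpair /lin big_cons cReD cReM.
rewrite E (_ : (fun r' => _) = fun r' =>
    (complex.Re p.2 * ((r' (- p.1) + r' (- - p.1)) / 2)
     - complex.Im p.2 * ((r' (- p.1) - r' (- - p.1)) / 2)) + lpair (unhart r') t);
  last by apply/funext => r'; rewrite E.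
apply: cvgD IH; apply: cvgB; apply: cvgMl_tmp; apply: cvgMr_tmp.
  by apply: cvgD; exact: pc.
by apply: cvgB; exact: pc.
Qed.

Lemma pair_unhart_near t (r : {ptws Z -> R}) (e : R) : 0 < e ->
  nbhs r [set r' : {ptws Z -> R} | `|lpair (unhart r') t - lpair (unhart r) t| <= e].
Proof.
move=> e0; have pc k : (fun r' : Z -> R => r' k) @ (nbhs r) --> r k.
  exact: (@proj_continuous _ (fun=> R) k r).
have := @pair_unhart_cvg t (nbhs r) r (nbhs_filter r) pc.
move=> /(@cvgrPdist_le _ _ _ _ (fmap_filter _ (nbhs_filter r)))/(_ e e0).
by apply: (@filterS _ _ (nbhs_filter r)) => r' /=; rewrite distrC.
Qed.

End Hartley.

(** * A spanning criterion for row vectors *)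

Section RowSpace.
Variables (F : fieldType) (M : nat).

(** A linear subspace contained in no hyperplane is everything. A matrix of maximal rank with rows
    in [W] has [W] in its row space, and a nonzero column of its cokernel would define a hyperplane
    containing [W]. *)
Lemma subspace_full (W : set 'rV[F]_M) :
  (forall a u v, W u -> W v -> W (a *: u + v)) -> W 0 ->
  (forall c : 'cV[F]_M, (forall w, W w -> w *m c = 0) -> c = 0) ->
  forall w, W w.
Proof.
move=> Wl W0 Wc.
have Wsum n (u : 'rV[F]_n) (A : 'M[F]_(n, M)) : (forall i, W (row i A)) -> W (u *m A).
  move=> hA; rewrite mulmx_sum_row; elim/big_rec: _ => // i x _ Wx.
  exact: Wl.
pose P n := `[< exists A : 'M[F]_M, (forall i, W (row i A)) /\ \rank A = n >].
have exP : exists n, P n.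
  by exists (\rank (0 : 'M[F]_M)); apply/asboolP; exists 0; split=> // i; rewrite row0.
have ubP n : P n -> (n <= M)%N by move=> /asboolP[A [_ <-]]; exact: rank_leq_row.
case: (ex_maxnP exP ubP) => n /asboolP[A [WA rA]] maxn.
have WsA w : W w -> (w <= A)%MS.
  move=> Ww; apply: contraT => nwA.
  suff : (\rank (A + w)%MS <= n)%N.
    rewrite leqNgt -rA => /negP[]; apply: rank_ltmx.
    by rewrite /ltmx addsmxSl /= addsmx_sub submx_refl.
  apply: maxn; apply/asboolP; exists (A + w)%MS; split=> // i.
  have /sub_addsmxP[[u1 u2] /= ->] := row_sub i (A + w)%MS.
  rewrite -[u1 *m A]scale1r; apply: Wl; first exact: Wsum.
  by apply: Wsum => j; rewrite ord1 row_id.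
have cA0 : cokermx A = 0.
  apply/matrixP => i j; rewrite [RHS]mxE.
  have /matrixP/(_ i 0) : col j (cokermx A) = 0.
    apply: Wc => w /WsA /submxP[v ->].
    by rewrite colE mulmxA -(mulmxA v) mulmx_coker mulmx0 mul0mx.
  by rewrite [LHS]mxE [RHS]mxE.
move=> w; have /submxP[v ->] : (w <= A)%MS by rewrite submxE cA0 mulmx0.
exact: Wsum.
Qed.

End RowSpace.

(** * The native space and its null-space component *)

Section NativeSpace.
Variables (R : realType) (d : nat) (Lh : Zd d -> R[i]) (s : seq (Zd d)).
Notation Z := (Zd d).
Notation X := {ptws Z -> R}.
Implicit Types (t : tlist R d) (f g p : Z -> R[i]) (r : Z -> R) (k : Z).
Hypothesis hLh : Defs.hermitian Lh.
Hypothesis us : uniq s.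
Hypothesis sP : forall k, (k \in s) = (Lh k == 0).
Hypothesis sLd : slow_growth (Ldag Lh).

Lemma pair_Lapp f t : lpair (Lapp Lh f) t = lpair f (tweight (fun k => Lh (- k)) t).
Proof. by rewrite /lpair lin_weight. Qed.

Lemma Lapp_lin (a b : R) f1 f2 : Lapp Lh (fun k => a%:C * f1 k + b%:C * f2 k) =
  (fun k => a%:C * Lapp Lh f1 k + b%:C * Lapp Lh f2 k).
Proof. by apply/funext => k; rewrite /Lapp mulrDr !(mulrCA (Lh k)). Qed.

Lemma hermitian_Lapp f : Defs.hermitian f -> Defs.hermitian (Lapp Lh f).
Proof. exact: hermitianM. Qed.

Lemma LhN k : (Lh (- k) == 0) = (Lh k == 0).
Proof. by rewrite hLh conjc_eq0. Qed.

Lemma TVnorm_ge0 (v : Z -> R[i]) : (0 <= TVnorm v)%E.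
Proof.
apply: le_trans (_ : (`|tpair v (trig_of [::])|%:E <= _)%E); first by rewrite lee_fin.
apply: ereal_sup_ubound; exists (trig_of [::]) => //; split.
  by move=> k; rewrite !tcoef_trig_of /coef /lin !big_nil conjc0.
by move=> x; rewrite teval_trig_of /ev /lin big_nil normr0.
Qed.

Lemma TVnorm_fin f : ML Lh f -> exists2 tau : R, TVnorm (Lapp Lh f) = tau%:E &
  0 <= tau /\ tvb (Lapp Lh f) tau.
Proof.
move=> [_ [[_ hf] fin]]; have := TVnorm_ge0 (Lapp Lh f).
case E : (TVnorm (Lapp Lh f)) fin => [tau| |] // _; rewrite lee_fin => t0.
by exists tau => //; split=> //; apply/tvbP => //; rewrite E.
Qed.

Lemma nc_le_tvb (v : Z -> R[i]) T k : tvb v T -> nc (v k) <= 2 * T.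
Proof.
move=> H; rewrite mulr_natl mulr2n lerD //; first exact: tvb_coef_Re.
exact: tvb_coef_Im.
Qed.

Definition off_null f : Z -> R[i] := fun k => if Lh k == 0 then 0 else f k.
Definition on_null f : Z -> R[i] := fun k => if Lh k == 0 then f k else 0.

Lemma Lapp_off_null f : Lapp Lh (off_null f) = Lapp Lh f.
Proof. by apply/funext => k; rewrite /Lapp /off_null; case: eqP => // ->; rewrite !mul0r. Qed.

Lemma nc_off_null f T k : tvb (Lapp Lh f) T -> nc (off_null f k) <= nc (Ldag Lh k) * (2 * T).
Proof.
move=> fT; have T0 := tvb_ge0 fT; rewrite /off_null; case: ifPn => k0.
  by rewrite {1}/nc normr0 addr0 mulr_ge0 ?nc_ge0 // mulr_ge0.
have -> : f k = Ldag Lh k * Lapp Lh f k.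
  by rewrite /Ldag (negbTE k0) /Lapp mulKf.
by apply: le_trans (ncM _ _) _; rewrite ler_wpM2l ?nc_ge0 ?nc_le_tvb.
Qed.

Lemma nc_on_null f k : nc (on_null f k) <= \sum_(l <- s) nc (f l).
Proof.
rewrite /on_null -sP; case: ifPn => ks.
  by rewrite (big_rem k) //= lerDl sumr_ge0 // => l _; exact: nc_ge0.
by rewrite {1}/nc normr0 addr0 sumr_ge0 // => l _; exact: nc_ge0.
Qed.

Lemma split_null f : f = fun k => off_null f k + on_null f k.
Proof.
by apply/funext => k; rewrite /off_null /on_null; case: ifP; rewrite ?add0r ?addr0.
Qed.

(** Slow growth comes for free: off the null frequencies it is inherited from [Ldag], and only the
    finitely many coefficients indexed by [s] remain. *)
Lemma ML_tvb f T : Defs.hermitian f -> tvb (Lapp Lh f) T -> ML Lh f.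
Proof.
move=> hf fT; split; last split.
- split=> //; have /slow_growthP[A [N HA]] := sLd.
  apply/slow_growthP; exists (A * (2 * T) + \sum_(l <- s) nc (f l)), N => k.
  rewrite {1}(split_null f); apply: le_trans (ncD _ _) _; rewrite mulrDl; apply: lerD.
    apply: le_trans (nc_off_null _ fT) _; rewrite mulrAC ler_wpM2r //.
    by rewrite mulr_ge0 // (tvb_ge0 fT).
  apply: le_trans (nc_on_null _ _) _; rewrite ler_peMr ?knorm_pow_ge1 //.
  by rewrite sumr_ge0 // => l _; exact: nc_ge0.
- split; last exact: hermitian_Lapp.
  by apply: (@slow_growth_bounded _ _ _ (2 * T)) => k; exact: nc_le_tvb.
- apply: le_lt_trans (_ : (_ <= T%:E)%E) _; last exact: ltry.
  by apply/tvbP => //; exact: hermitian_Lapp.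
Qed.

Lemma in_null_on_null f : Defs.hermitian f -> in_null Lh (on_null f).
Proof.
move=> hf; split; last first.
  by move=> k; rewrite /Lapp /on_null; case: eqP => [->|_]; rewrite ?mul0r ?mulr0.
split; first exact: slow_growth_bounded (nc_on_null f).
by move=> k; rewrite /on_null LhN hf; case: ifP => // _; rewrite conjc0.
Qed.

Lemma tvb_Lapp_null p : in_null Lh p -> tvb (Lapp Lh p) 0.
Proof.
move=> [_ hp] t c tc; rewrite /lpair /lin big1; first by rewrite normr0 mul0r.
by move=> q _; rewrite hp mulr0.
Qed.

(** Continuity of the pairing for coefficientwise convergence holds relative to a TV bound, hence
    the implication inside the neighbourhood. *)
Lemma wpair_near g T r (e : R) : CL Lh g -> tvb (Lapp Lh (unhart r)) T -> 0 < e ->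
  nbhs (r : X) [set r' : X | tvb (Lapp Lh (unhart r')) T ->
     `|wpair g (unhart r') - wpair g (unhart r)| <= e].
Proof.
move=> gL rT e0; have T1 : 0 < T + 1 by apply: ltr_wpDl => //; exact: tvb_ge0 rT.
have e3 : 0 < e / 3 by rewrite divr_gt0.
have [t Ht] := wpair_approx hLh sP gL (divr_gt0 e3 T1).
have small : T * (e / 3 / (T + 1)) <= e / 3.
  by rewrite mulrA ler_pdivrMr // mulrC ler_pM2l //; lra.
apply: (@filterS _ _ (nbhs_filter (r : X))) (pair_unhart_near t (r : X) e3).
move=> r' /= + rT'; have := le_trans (Ht _ _ rT) small; have := le_trans (Ht _ _ rT') small.
by rewrite !ler_norml => /andP[? ?] /andP[? ?] /andP[? ?]; apply/andP; lra.
Qed.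

(** Each test pairing depends on finitely many coefficients, so a TV bound survives in the
    coefficientwise closure. *)
Lemma tvb_closed r T :
  (forall B, nbhs (r : X) B -> exists2 r', B r' & tvb (Lapp Lh (unhart r')) T) ->
  tvb (Lapp Lh (unhart r)) T.
Proof.
move=> H t c tc; apply/ler_addgt0Pr => e e0; rewrite pair_Lapp.
have [r' /= h1 /(_ _ _ tc)] := H _ (pair_unhart_near (tweight (fun k => Lh (- k)) t) (r : X) e0).
move: h1; rewrite pair_Lapp !ler_norml => /andP[? ?] /andP[? ?]; apply/andP; lra.
Qed.

Section NullCoordinates.
Variables (M : nat) (nu : 'I_M -> (Z -> R[i])).
Hypothesis hnu : forall m, CL Lh (nu m).
Hypothesis hinj : forall p, in_null Lh p -> (forall m, wpair (nu m) p = 0) -> p = (fun _ => 0).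

(** Inverse Hartley transforms of unit vectors: a real basis indexed by the null frequencies
    themselves, with no choice of a representative in each pair k, -k. *)
Definition null_basis (i : 'I_(size s)) : Z -> R[i] :=
  unhart (fun k => (k == tnth (in_tuple s) i)%:R).
Definition nullsp_fun (c : 'rV[R]_(size s)) : Z -> R[i] :=
  fun k => \sum_i (c 0 i)%:C * null_basis i k.

Lemma unhart0 r k : (forall l, Lh l != 0 -> r l = 0) -> Lh k != 0 -> unhart r k = 0.
Proof.
by move=> h k0; rewrite /unhart !h ?LhN //; apply: complex_eqP => /=; lra.
Qed.

Lemma nullsp_funE c : nullsp_fun c =
  unhart (fun k => \sum_i c 0 i * (k == tnth (in_tuple s) i)%:R).
Proof.
apply/funext => k; rewrite /nullsp_fun /unhart; apply: complex_eqP => /=.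
  rewrite cRe_sum -big_split mulr_suml; apply: eq_bigr => i _.
  by rewrite cReMl /=; lra.
rewrite cIm_sum -sumrB mulr_suml; apply: eq_bigr => i _.
by rewrite cImMl /=; lra.
Qed.

Lemma nullsp_fun_in_null c : in_null Lh (nullsp_fun c).
Proof.
have E : nullsp_fun c = on_null (nullsp_fun c).
  apply/funext => k; rewrite /on_null; case: ifPn => // k0; rewrite nullsp_funE.
  apply: unhart0 => // l l0; rewrite big1 // => i _.
  case: eqP => [li|_]; rewrite ?mulr0 //; move: l0.
  by rewrite -sP li mem_tnth.
by rewrite E; apply: in_null_on_null; rewrite nullsp_funE; exact: unhart_hermitian.
Qed.

Lemma null_basis_in_null i : in_null Lh (null_basis i).
Proof.
have -> : null_basis i = nullsp_fun (delta_mx 0 i).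
  apply/funext => k; rewrite /nullsp_fun (bigD1 i) //= mxE !eqxx mul1r big1 ?addr0 //.
  by move=> j /negbTE ji; rewrite mxE ji andbF mul0r.
exact: nullsp_fun_in_null.
Qed.

Lemma nullsp_funP p : in_null Lh p -> p = nullsp_fun (\row_i hart p (tnth (in_tuple s) i)).
Proof.
move=> [[_ hp] p0]; rewrite nullsp_funE -{1}(hartK hp); congr unhart; apply/funext => k.
under eq_bigr => i _ do rewrite mxE.
transitivity (\sum_(l <- s) hart p l * (k == l)%:R); last first.
  by rewrite [LHS]big_tnth.
have [ks|ks] := boolP (k \in s).
  rewrite (bigD1_seq k) //= eqxx mulr1 big1 ?addr0 // => l lk.
  by rewrite eq_sym (negbTE lk) mulr0.
rewrite big_seq big1 => [|l ls]; last first.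
  by case: eqP => [kl|_]; rewrite ?mulr0 //; move: ks; rewrite kl ls.
have /eqP := p0 k; rewrite mulf_eq0 -sP (negbTE ks) /= /hart => /eqP ->.
by rewrite addr0.
Qed.

Lemma nuvec_nullsp_fun c :
  nuvec nu (nullsp_fun c) = c *m (\matrix_(i, m) wpair (nu m) (null_basis i)).
Proof.
apply/rowP => m; rewrite !mxE (wpair_sum hLh sP) //.
  by apply: eq_bigr => i _; rewrite mxE.
by move=> i; exists 0; apply: tvb_Lapp_null; exact: null_basis_in_null.
Qed.

(** Injectivity of [nu] on the null space made quantitative: the pseudoinverse of the measurement
    matrix recovers the coordinates of p. *)
Lemma null_bound : exists2 A : R, 0 <= A & forall p (c : R), in_null Lh p -> 0 <= c ->
  (forall m, `|wpair (nu m) p| <= c) -> forall k, `|hart p k| <= A * c.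
Proof.
pose B := \matrix_(i, m) wpair (nu m) (null_basis i).
exists (\sum_i \sum_m `|pinvmx B m i|).
  by apply: sumr_ge0 => i _; apply: sumr_ge0.
move=> p c pN c0 pc k.
set A := \sum_i _; have A0 : 0 <= A * c.
  by rewrite mulr_ge0 //; apply: sumr_ge0 => i _; apply: sumr_ge0.
pose w := nuvec nu p; pose c' := w *m pinvmx B.
(* Since [w] lies in the row space of [B], both sides have the same measurements, and injectivity
   identifies them. *)
have pE : p = nullsp_fun c'.
  have : (fun k => 1%:C * p k + (-1)%:C * nullsp_fun c' k) = (fun=> 0).
    apply: hinj.
      have [[sp hp] p0] := pN; have [[sc hc] c'0] := nullsp_fun_in_null c'.
      split; first by split; [exact: slow_growth_lin|exact: hermitian_lin].
      move=> l; rewrite -/(Lapp Lh _ l) Lapp_lin /=.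
      by rewrite p0 c'0 !mulr0 addr0.
    move=> m; rewrite (wpair_lin hLh sP 1 (-1) (hnu m) (tvb_Lapp_null pN)
      (tvb_Lapp_null (nullsp_fun_in_null c'))).
    have /rowP/(_ m) : nuvec nu (nullsp_fun c') = w.
      rewrite nuvec_nullsp_fun -/B /c' mulmxKpV // /w {1}(nullsp_funP pN) nuvec_nullsp_fun.
      exact: submxMl.
    by rewrite !mxE => ->; lra.
  move=> h; apply/funext => l; have e := congr1 (fun q => q l) h.
  by apply: complex_eqP; [have := congr1 (@complex.Re R) e|have := congr1 (@complex.Im R) e];
    rewrite !(cReD, cImD, cReMl, cImMl) /=; lra.
have [ks|ks] := boolP (k \in s); last first.
  have [_ p0] := pN; have /eqP := p0 k; rewrite mulf_eq0 -sP (negbTE ks) /= /hart => /eqP ->.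
  by rewrite addr0 normr0.
have [i ki] : exists i, k = tnth (in_tuple s) i by exact/tnthP.
have -> : hart p k = c' 0 i.
  rewrite pE nullsp_funE unhartK (bigD1 i) //= ki eqxx mulr1 big1 ?addr0 // => j ji.
  by rewrite (inj_eq (elimT (@tuple_uniqP _ _ (in_tuple s)) us)) eq_sym (negbTE ji) mulr0.
rewrite mxE; apply: le_trans (ler_norm_sum _ _ _) _.
apply: le_trans (_ : \sum_m c * `|pinvmx B m i| <= _).
  apply: ler_sum => m _; rewrite normrM; apply: ler_wpM2r => //.
  by rewrite mxE.
rewrite -mulr_sumr mulrC; apply: ler_wpM2r => //.
rewrite /A (bigD1 i) //= lerDl; apply: sumr_ge0 => j _; exact: sumr_ge0.
Qed.

End NullCoordinates.
End NativeSpace.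

(** * Sublevel sets of the objective *)

Lemma rowV_norm_ge (R : realType) (M : nat) (w : 'rV[R]_M) m : `|w 0 m| <= `|w|.
Proof.
rewrite [leRHS]/Num.norm /= mx_normrE.
exact: (le_bigmax _ (fun ij : 'I_1 * 'I_M => `|w ij.1 ij.2|) (0, m)).
Qed.

(** The sets [f i] need only be neighbourhoods. Without a finite subcover, the points missed by
    finite subfamilies form a proper filter, and a cluster point in [A] contradicts the
    neighbourhood [f i] covering it. *)
Lemma compact_local_cover (T : topologicalType) (A : set T) (J : Type) (f : J -> set T) :
  compact A -> (forall p, A p -> exists i, nbhs p (f i)) ->
  exists (n : nat) (h : 'I_n -> J), forall p, A p -> exists j, f (h j) p.
Proof.
move=> cA cov; apply: contrapT => no.
pose B (l : seq J) := [set p | A p /\ all (fun i => ~~ `[< f i p >]) l].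
have B0 l : B l !=set0.
  apply: contrapT => Bl; apply: no; exists (size l), (tnth (in_tuple l)) => p Ap.
  have : ~~ all (fun i => ~~ `[< f i p >]) l by apply/negP => h; apply: Bl; exists p.
  rewrite -has_predC => /(@has_tnthP _ _ _ (in_tuple l))[j /=]; rewrite negbK => /asboolP fj.
  by exists j.
have FF : ProperFilter (filter_from setT B).
  apply: filter_from_proper; last by move=> l _; exact: B0.
  apply: filter_from_filter; first by exists [::].
  move=> l l' _ _; exists (l ++ l') => // p [Ap]; rewrite all_cat => /andP[? ?].
  by split; split.
have FA : filter_from setT B A by exists [::] => // p [].
have [p [Ap pcl]] := cA _ FF FA; have [i fi] := cov _ Ap.
have [|q [[_ /=]]] := pcl (B [:: i]) (f i) _ fi; first by exists [:: i].
by rewrite andbT => /asboolP.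
Qed.

Section Sublevels.
Variables (R : realType) (d : nat) (Lh : Zd d -> R[i]) (s : seq (Zd d)).
Notation Z := (Zd d).
Notation X := {ptws Z -> R}.
Implicit Types (t : tlist R d) (f g p : Z -> R[i]) (r : Z -> R) (k : Z).
Hypothesis hLh : Defs.hermitian Lh.
Hypothesis us : uniq s.
Hypothesis sP : forall k, (k \in s) = (Lh k == 0).
Hypothesis sLd : slow_growth (Ldag Lh).
Variables (M : nat) (nu : 'I_M -> (Z -> R[i])).
Hypothesis hnu : forall m, CL Lh (nu m).
Hypothesis hinj : forall p, in_null Lh p -> (forall m, wpair (nu m) p = 0) -> p = (fun _ => 0).
Variables (Ey : 'rV[R]_M -> \bar R) (lam : R).
Hypothesis Ege0 : forall w, (0 <= Ey w)%E.
Hypothesis Elsc : lower_semicontinuous Ey.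
Hypothesis Econv : forall (w1 w2 : 'rV[R]_M) (t : R), 0 <= t <= 1 ->
  (Ey (t *: w1 + (1 - t) *: w2)%R <= t%:E * Ey w1 + ((1 - t)%R)%:E * Ey w2)%E.
Hypothesis Ecoer : forall A : R, exists r : R, forall w : 'rV[R]_M, r < `|w| -> (A%:E < Ey w)%E.
Hypothesis lam0 : 0 < lam.

Definition objective f : \bar R := (Ey (nuvec nu f) + lam%:E * TVnorm (Lapp Lh f))%E.
Definition sublevel (a : R) : set (Z -> R[i]) :=
  [set f | ML Lh f /\ (objective f <= a%:E)%E].

(** Trades an inequality of extended reals for real witnesses: nonnegativity of [Ey] excludes -oo
    and the bound [a] excludes +oo. *)
Lemma sublevelP f (a : R) : ML Lh f ->
  (objective f <= a%:E)%E <-> exists e tau : R,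
    [/\ (Ey (nuvec nu f) <= e%:E)%E, tvb (Lapp Lh f) tau & e + lam * tau <= a].
Proof.
move=> fM; have [tau Etau [tau0 ftau]] := TVnorm_fin fM; rewrite /objective Etau -EFinM.
split=> [|[e [tau' [He Htau' Ha]]]].
  have := Ege0 (nuvec nu f).
  case: (Ey _) => [e| |] //; rewrite lee_fin => e0.
  by rewrite -EFinD lee_fin => h; exists e, tau.
have hf : Defs.hermitian (Lapp Lh f) by have [_ [[_ ?] _]] := fM.
have : (tau%:E <= tau'%:E)%E by rewrite -Etau; apply/tvbP.
rewrite lee_fin => tt'; apply: le_trans (leeD He (lexx _)) _.
rewrite -EFinD lee_fin; apply: le_trans Ha; rewrite lerD2l.
by rewrite ler_pM2l.
Qed.

Lemma objective_ge0 f : (0 <= objective f)%E.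
Proof. by rewrite adde_ge0 // mule_ge0 ?TVnorm_ge0 // lee_fin ltW. Qed.

Lemma sublevel_hermitian a f : sublevel a f -> Defs.hermitian f.
Proof. by move=> [[[_ ?] _] _]. Qed.

Lemma sublevel_tvb a f : sublevel a f -> tvb (Lapp Lh f) (a / lam).
Proof.
move=> [fM /(sublevelP _ fM)[e [tau [He Ht Ha]]]].
apply: tvbW Ht; rewrite ler_pdivlMr // mulrC.
have : (0 <= e%:E)%E by apply: le_trans He.
by rewrite lee_fin; lra.
Qed.

Lemma sublevel_E a f : sublevel a f -> (Ey (nuvec nu f) <= a%:E)%E.
Proof.
move=> [fM /(sublevelP _ fM)[e [tau [He Ht Ha]]]].
apply: le_trans He _; rewrite lee_fin; apply: le_trans Ha; rewrite lerDl.
by rewrite mulr_ge0 ?(tvb_ge0 Ht) // ltW.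
Qed.

Lemma sublevel_mono a b f : a <= b -> sublevel a f -> sublevel b f.
Proof. by move=> ab [fM h]; split=> //; apply: le_trans h _; rewrite lee_fin. Qed.

(** The TV bound controls the off-null coefficients and hence their measurements. Subtracting these
    from [nuvec nu f], which coercivity bounds, leaves a bound on the measurements of the null
    part. *)
Lemma sublevel_bounded a : exists B : Z -> R, forall f, sublevel a f -> forall k, `|hart f k| <= B k.
Proof.
pose T := a / lam; have [r0 Hr0] := Ecoer a.
have [A A0 HA] := null_bound hLh us sP hnu hinj.
pose b1 k := nc (Ldag Lh k) * (2 * T).
(* Any fixed accuracy will do, so 1 is taken. *)
have /choice[tm Htm] m := wpair_approx hLh sP (hnu m) ltr01.
pose c := `|r0| + \sum_m (`|T| + \sum_(p <- tm m) nc p.2 * `|b1 (- p.1)|).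
exists (fun k => b1 k + A * c) => f fa k.
have fT : tvb (Lapp Lh f) T := sublevel_tvb fa.
have hf := sublevel_hermitian fa.
have off k' : nc (off_null Lh f k') <= b1 k' by exact: nc_off_null.
have -> : hart f k = hart (off_null Lh f) k + hart (on_null Lh f) k.
  by rewrite {1}(split_null Lh f) /hart cReD cImD addrACA.
apply: le_trans (ler_normD _ _) _; apply: lerD.
  by apply: le_trans (off k); exact: ler_normD.
have hp : in_null Lh (on_null Lh f) := in_null_on_null hLh sP hf.
apply: HA => // [|m].
  rewrite addr_ge0 // sumr_ge0 // => m _; rewrite addr_ge0 // sumr_ge0 // => p _.
  by rewrite mulr_ge0 // nc_ge0.
have T1 : tvb (Lapp Lh (off_null Lh f)) T by rewrite Lapp_off_null.
have : wpair (nu m) f = wpair (nu m) (off_null Lh f) + wpair (nu m) (on_null Lh f).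
  have := wpair_lin hLh sP 1 1 (hnu m) T1 (tvb_Lapp_null hp); rewrite !mul1r => <-.
  by congr wpair; rewrite {1}(split_null Lh f); apply/funext => l; rewrite !mul1r.
move=> wf; have -> : wpair (nu m) (on_null Lh f) = wpair (nu m) f - wpair (nu m) (off_null Lh f).
  by rewrite wf addrC addKr.
apply: le_trans (ler_normB _ _) _; apply: lerD.
  have := rowV_norm_ge (nuvec nu f) m; rewrite mxE => /le_trans; apply.
  apply: le_trans (ler_norm r0); rewrite leNgt; apply/negP => /Hr0.
  by rewrite ltNge sublevel_E.
rewrite (bigD1 m) //=; apply: ler_wpDr.
  rewrite sumr_ge0 // => j _; rewrite addr_ge0 // sumr_ge0 // => p _.
  by rewrite mulr_ge0 // nc_ge0.
have h1 := Htm m _ _ T1; rewrite mulr1 in h1.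
have h2 : `|lpair (off_null Lh f) (tm m)| <= \sum_(p <- tm m) nc p.2 * `|b1 (- p.1)|.
  apply: (pair_bound _ (b := fun k => `|b1 k|)) => k'.
  exact: le_trans (off k') (ler_norm _).
rewrite -[wpair _ _](subrK (lpair (off_null Lh f) (tm m))).
apply: le_trans (ler_normD _ _) _; apply: lerD h2.
exact: le_trans h1 (ler_norm _).
Qed.

Lemma nuvec_near r T (U : set 'rV[R]_M) : tvb (Lapp Lh (unhart r)) T ->
  nbhs (nuvec nu (unhart r)) U ->
  nbhs (r : X) [set r' : X | tvb (Lapp Lh (unhart r')) T -> U (nuvec nu (unhart r'))].
Proof.
move=> rT /nbhs_ballP[e /= e0 eU].
have e2 : 0 < e / 2 by rewrite divr_gt0.
have := @filter_forall X _ _ (nbhs (r : X)) (nbhs_filter (r : X))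
  (fun m => wpair_near hLh sP (hnu m) rT e2).
apply: (@filterS _ _ (nbhs_filter (r : X))) => r' /= H rT'.
apply: eU; split=> // i m; rewrite ord1 /ball /= !mxE distrC.
by apply: le_lt_trans (H m rT') _; lra.
Qed.

(** The bound is shared between the two summands: for each b below [Ey] at r, nearby members of the
    sublevel set have [Ey] above b, hence TV at most (a - b) / lam, and this passes to r. Then b
    tends to the value of [Ey]. *)
Lemma sublevel_closed a : closed [set r : X | sublevel a (unhart r)].
Proof.
move=> r rcl; pose T := a / lam.
have rT : tvb (Lapp Lh (unhart r)) T.
  apply: tvb_closed => B /rcl[r' [r'a Br']]; exists r' => //.
  exact: sublevel_tvb r'a.
have fM : ML Lh (unhart r) by apply: ML_tvb rT => //; exact: unhart_hermitian.
split=> //.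
have key (b : R) : (b%:E < Ey (nuvec nu (unhart r)))%E ->
    tvb (Lapp Lh (unhart r)) ((a - b) / lam).
  move=> /Elsc[U nU HU]; apply: tvb_closed => B nB.
  have := rcl _ (@filterI _ _ (nbhs_filter (r : X)) _ _ nB (nuvec_near rT nU)).
  move=> [r' [r'a [Br' /(_ (sublevel_tvb r'a))/HU bE]]]; exists r' => //.
  have [r'M /(sublevelP _ r'M)[e [tau [He Ht Ha]]]] := r'a.
  apply: tvbW Ht; rewrite ler_pdivlMr // mulrC.
  have := lt_le_trans bE He; rewrite lte_fin; lra.
have ub (b : R) : (b%:E < Ey (nuvec nu (unhart r)))%E -> b <= a.
  by move=> /key/tvb_ge0; rewrite pmulr_lge0 ?invr_gt0 // subr_ge0.
apply/sublevelP => //; have := Ege0 (nuvec nu (unhart r)).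
case E : (Ey _) => [e| |] //; last first.
  by move=> _; have := ub (a + 1); rewrite E ltry gerDl ler10 => /(_ isT).
rewrite lee_fin => e0; exists e, ((a - e) / lam); split=> //; last first.
  by rewrite mulrCA mulfV ?mulr1 ?gt_eqF //; lra.
move=> t c tc; apply/ler_addgt0Pr => h h0.
have c0 : 0 <= c by exact: le_trans (normr_ge0 _) (tc (fun=> 0)).
have c1 : 0 < c + 1 by lra.
(* This defect in b costs h c / (c + 1) <= h in the bound on the pairing. *)
have hh : 0 < h * lam / (c + 1) by rewrite divr_gt0 ?mulr_gt0.
have /key/(_ _ _ tc)/le_trans : ((e - h * lam / (c + 1))%:E < Ey (nuvec nu (unhart r)))%E.
  by rewrite E lte_fin; lra.
apply; rewrite (_ : _ * c = (a - e) / lam * c + h * (c / (c + 1))); last first.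
  by field; rewrite !gt_eqF.
by rewrite lerD2l ler_piMr ?(ltW h0) // ler_pdivrMr //; lra.
Qed.

Lemma sublevel_compact a : compact [set r : X | sublevel a (unhart r)].
Proof.
have [B HB] := sublevel_bounded a.
have cK : compact [set r : X | forall k, `[- B k, B k]%classic (r k)].
  exact: (@tychonoff _ (fun=> R) (fun k => `[- B k, B k]%classic)
    (fun k => @segment_compact _ _ _)).
apply: subclosed_compact cK _; first exact: sublevel_closed.
move=> r /= ra k; rewrite /= in_itv /= -ler_norml.
by have := HB _ ra k; rewrite unhartK.
Qed.

Lemma ML_lin (a b : R) f1 f2 : ML Lh f1 -> ML Lh f2 ->
  ML Lh (fun k => a%:C * f1 k + b%:C * f2 k).
Proof.
move=> f1M f2M; have [t1 _ [_ h1]] := TVnorm_fin f1M; have [t2 _ [_ h2]] := TVnorm_fin f2M.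
have [[_ hf1] _] := f1M; have [[_ hf2] _] := f2M.
apply: (ML_tvb hLh sP sLd (T := `|a| * t1 + `|b| * t2)); first exact: hermitian_lin.
by rewrite Lapp_lin; exact: tvb_lin.
Qed.

Lemma nuvec_lin (a b : R) f1 f2 : ML Lh f1 -> ML Lh f2 ->
  nuvec nu (fun k => a%:C * f1 k + b%:C * f2 k) = a *: nuvec nu f1 + b *: nuvec nu f2.
Proof.
move=> f1M f2M; have [t1 _ [_ h1]] := TVnorm_fin f1M; have [t2 _ [_ h2]] := TVnorm_fin f2M.
by apply/rowP => m; rewrite !mxE (wpair_lin hLh sP a b (hnu m) h1 h2).
Qed.

Lemma sublevel_convex a : real_convex_set (sublevel a).
Proof.
move=> f1 f2 t [f1M /(sublevelP _ f1M)[e1 [t1 [He1 Ht1 Ha1]]]].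
move=> [f2M /(sublevelP _ f2M)[e2 [t2 [He2 Ht2 Ha2]]]] /andP[t0 t1'].
have cM : ML Lh (comb t f1 f2) by exact: ML_lin.
split=> //; apply/sublevelP => //; exists (t * e1 + (1 - t) * e2), (t * t1 + (1 - t) * t2).
have t'0 : 0 <= 1 - t by lra.
split.
- rewrite /comb nuvec_lin //; apply: le_trans (Econv _ _ _) _; first by rewrite t0.
  rewrite (_ : (t * e1 + (1 - t) * e2)%:E = (t%:E * e1%:E + (1 - t)%:E * e2%:E)%E) //.
  by apply: leeD; apply: lee_wpmul2l => //; rewrite lee_fin.
- rewrite /comb Lapp_lin; have := tvb_lin t (1 - t) Ht1 Ht2.
  by rewrite !ger0_norm.
- have -> : t * e1 + (1 - t) * e2 + lam * (t * t1 + (1 - t) * t2) =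
    t * (e1 + lam * t1) + (1 - t) * (e2 + lam * t2) by ring.
  apply: le_trans (lerD (ler_wpM2l t0 Ha1) (ler_wpM2l t'0 Ha2)) _; lra.
Qed.

Lemma sublevel_wstar_compact a : wstar_compact Lh (sublevel a).
Proof.
split=> [f []//|I O Oo cov].
(* Relative to the sublevel set, whose members share the bound a / lam, each [U i] is a
   coefficientwise neighbourhood of the points it covers. *)
pose U (i : I) : set X := [set r' : X | sublevel a (unhart r') -> O i (unhart r')].
have [r /= ra|n [h Hh]] := compact_local_cover (f := U) (@sublevel_compact a).
  have [i Oi] := cov _ ra; exists i.
  have [OM /(_ _ Oi)[n [g [e [gL [e0 gO]]]]]] := Oo i.
  have e2 : 0 < e / 2 by rewrite divr_gt0.
  have := @filter_forall X _ _ (nbhs r) (nbhs_filter r)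
    (fun i => wpair_near hLh sP (gL i) (sublevel_tvb ra) e2).
  apply: (@filterS _ _ (nbhs_filter r)) => r' /= H r'a.
  apply: gO; split; first by case: r'a.
  move=> j; apply: le_lt_trans (H j (sublevel_tvb r'a)) _; lra.
exists n, h => f fa; have fa' : sublevel a (unhart (hart f)).
  by rewrite hartK //; exact: sublevel_hermitian fa.
have [j /(_ fa')] := Hh (hart f) fa'.
by rewrite hartK; [exists j|exact: sublevel_hermitian fa].
Qed.

(** A minimizing sequence has a cluster point by compactness. It lies in every closed sublevel set
    of height inf + 1/(n+1), so the infimum is attained. *)
Lemma sublevel_min f0 : ML Lh f0 -> (objective f0 < +oo)%E ->
  exists a : R, (exists f, sublevel a f) /\
    (forall g, ML Lh g -> (a%:E <= objective g)%E).
Proof.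
move=> f0M J0; pose S := [set a : R | exists f, sublevel a f].
have toS g : ML Lh g -> (objective g < +oo)%E -> exists2 b : R, S b & objective g = b%:E.
  move=> gM; have := objective_ge0 g; case E : (objective g) => [b| |] // _ _.
  by exists b => //; exists g; split=> //; rewrite E.
have hS : has_inf S.
  split; first by have [b Sb _] := toS _ f0M J0; exists b.
  exists 0 => b [g [gM gb]]; have := le_trans (objective_ge0 g) gb.
  by rewrite lee_fin.
pose a := inf S; exists a; split; last first.
  move=> g gM; have [glt|goo] := ltP (objective g) +oo%E; last first.
    by apply: le_trans goo; rewrite leey.
  have [b Sb ->] := toS g gM glt.
  by rewrite lee_fin; apply: ge_inf => //; case: hS.
have ne (n : nat) : exists r : X, sublevel (a + n.+1%:R^-1) (unhart r).
  have [b [g gb] ba] := @inf_adherent R S (n.+1%:R^-1) (harmonic_gt0 n) hS.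
  exists (hart g); rewrite hartK; last exact: sublevel_hermitian gb.
  exact: sublevel_mono (ltW ba) gb.
have [rn Hrn] := choice ne.
have mono n m : (n <= m)%N -> sublevel (a + n.+1%:R^-1) (unhart (rn m)).
  move=> nm; apply: sublevel_mono (Hrn m); rewrite lerD2l lef_pV2 ?posrE ?ltr0n //.
  by rewrite ler_nat.
have Fn n : (rn @ \oo) [set r : X | sublevel (a + n.+1%:R^-1) (unhart r)].
  by exists n => // m /= nm; exact: mono.
have [r [_ rcl]] := sublevel_compact (fmap_proper_filter rn _) (Fn 0%N).
have rn' n : sublevel (a + n.+1%:R^-1) (unhart r).
  by apply: sublevel_closed => B nB; apply: rcl => //; exact: Fn.
exists (unhart r); split; first by case: (rn' 0%N).
apply/lee_addgt0Pr => e e0; have [n _ /(_ n (leqnn n)) hn] := near_infty_natSinv_lt (PosNum e0).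
have [_ h] := rn' n; apply: le_trans h _; rewrite -EFinD lee_fin lerD2l.
exact: ltW hn.
Qed.

End Sublevels.

(** * Surjectivity of the measurements, finiteness of the null frequencies *)

Section Surjectivity.
Variables (R : realType) (d : nat) (Lh : Zd d -> R[i]) (s : seq (Zd d)).
Notation Z := (Zd d).
Hypothesis hLh : Defs.hermitian Lh.
Hypothesis sP : forall k, (k \in s) = (Lh k == 0).
Hypothesis sLd : slow_growth (Ldag Lh).
Variables (M : nat) (nu : 'I_M -> (Z -> R[i])).
Hypothesis hnu : forall m, Defs.hermitian (nu m).
Hypothesis hfree : forall c : 'I_M -> R,
  (fun k => \sum_(m < M) (c m)%:C * nu m k) = (fun _ => 0) -> forall m, c m = 0.

Lemma ML_trig (t : tlist R d) : Defs.hermitian (coef t) -> ML Lh (coef t).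
Proof.
move=> ht; have E : Lapp Lh (coef t) = coef (tweight Lh t).
  by apply/funext => k; rewrite coef_weight.
have [T HT] : exists T, tvb (coef (tweight Lh t)) T.
  by apply: tvb_trig; rewrite -E; exact: hermitian_Lapp.
by apply: (ML_tvb hLh sP sLd ht (T := T)); rewrite E.
Qed.

(** Polynomials already suffice: if a vector c annihilated all their measurements, testing on e_{-k}
    and -i e_{-k} would give a vanishing combination of the [nu m]. *)
Lemma nuvec_surj (w : 'rV[R]_M) : exists2 f, ML Lh f & nuvec nu f = w.
Proof.
pose W := [set w : 'rV[R]_M | exists2 t : tlist R d, Defs.hermitian (coef t) &
  w = \row_m lpair (nu m) t].
suff [t ht ->] : W w.
  exists (coef t); first exact: ML_trig.
  by apply/rowP => m; rewrite !mxE wpair_coef.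
move: w; apply: subspace_full.
- move=> a u v [t1 h1 ->] [t2 h2 ->]; exists (tscale a%:C t1 ++ t2).
    move=> k; rewrite !coef_cat !coef_scale h1 h2.
    by apply: complex_eqP; rewrite !(cReJ, cImJ, cReD, cImD, cReMl, cImMl); lra.
  by apply/rowP => m; rewrite !mxE pair_cat pair_scale.
- exists [::]; first by move=> k; rewrite /coef /lin !big_nil conjc0.
  by apply/rowP => m; rewrite !mxE /lpair /lin big_nil.
- move=> c Hc; apply/colP => m; rewrite [RHS]mxE.
  apply: (hfree (c := fun m => c m 0)); apply/funext => k.
  have key z : \sum_m c m 0 * complex.Re (z * nu m k) = 0.
    have : W (\row_m lpair (nu m) (trealpart [:: (- k, z)])).
      by exists (trealpart [:: (- k, z)]) => //; exact: trealpart_real.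
    move=> /Hc/matrixP/(_ 0 0); rewrite [LHS]mxE [RHS]mxE => e.
    apply: eq_trans e; apply: eq_bigr => j _; rewrite mxE pair_realpart // /lpair /lin big_seq1 /= opprK.
    by rewrite mulrC.
  apply: complex_eqP; rewrite ?cRe_sum ?cIm_sum /=.
    by rewrite -[RHS](key 1); apply: eq_bigr => j _; rewrite cReMl mul1r.
  rewrite -[RHS](key (0 +i* (-1))); apply: eq_bigr => j _; rewrite cImMl cReM /=.
  by rewrite mul0r sub0r mulN1r opprK.
Qed.

Lemma null_list (n : nat) :
  (forall l : seq Z, uniq l -> (forall k, k \in l -> Lh k = 0) -> (size l <= n)%N) ->
  exists2 l : seq Z, uniq l & forall k, (k \in l) = (Lh k == 0).
Proof.
move=> H; pose P m := `[< exists l : seq Z, [/\ uniq l, forall k, k \in l -> Lh k = 0 & size l = m] >].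
have exP : exists m, P m by exists 0%N; apply/asboolP; exists [::].
have ubP m : P m -> (m <= n)%N by move=> /asboolP[l [ul l0 <-]]; exact: H.
case: (ex_maxnP exP ubP) => m /asboolP[l [ul l0 lm]] mmax; exists l => // k.
apply/idP/eqP => [/l0 //|k0]; apply: contraT => kl.
have : P m.+1.
  apply/asboolP; exists (k :: l); split; rewrite /= ?kl ?lm // => j.
  by rewrite inE => /orP[/eqP -> //|/l0].
by move=> /mmax; rewrite ltnn.
Qed.

(** At each frequency the identities L Ld L = L and Ld L Ld = Ld determine Ld, so [Ldag] is the
    given pseudoinverse. *)
Lemma Ldag_slow : spline_admissible Lh -> slow_growth (Ldag Lh).
Proof.
move=> [_ [_ [Ld [[sg _] [h1 [h2 _]]]]]].
suff -> : Ldag Lh = Ld by [].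
apply/funext => k; rewrite /Ldag; case: eqP => [k0|/eqP k0].
  by rewrite -(h2 k) k0 mulr0 mul0r.
apply: (mulfI k0); rewrite mulfV //; apply: (mulIf k0).
by rewrite mul1r h1.
Qed.

End Surjectivity.

(** * Bounded sequences with finite-dimensional span of translates *)

Lemma bernoulli (R : realType) (e : R) n : 0 <= e -> 1 + n%:R * e <= (1 + e) ^+ n.
Proof.
move=> e0; elim: n => [|n IH]; first by rewrite mul0r addr0 expr0.
rewrite exprS; apply: le_trans (ler_wpM2l _ IH); last by rewrite addr_ge0.
have : 0 <= n%:R * (e * e) by rewrite mulr_ge0 ?mulr_ge0.
by rewrite -natr1; lra.
Qed.

Lemma linear_bounded (R : realType) (e B : R) : (forall n : nat, n%:R * e <= B) -> e <= 0.
Proof.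
move=> H; rewrite leNgt; apply/negP => e0.
have := archi_boundP (ltac:(exact: normr_ge0) : 0 <= `|B / e|); rewrite ltNge => /negP; apply.
apply: le_trans (ler_norm _); rewrite ler_pdivlMr //; exact: H.
Qed.

Lemma expn_bounded (R : realType) (x B : R) : (forall n, x ^+ n <= B) -> x <= 1.
Proof.
move=> H; rewrite leNgt; apply/negP => x1.
have e0 : 0 < x - 1 by lra.
suff : x - 1 <= 0 by lra.
apply: (@linear_bounded _ _ B) => n; have := bernoulli n (ltW e0).
rewrite (_ : 1 + (x - 1) = x); last by ring.
have := H n; lra.
Qed.

Section NormC.
Variable R : realType.
Implicit Types z w : R[i].
Definition nrm z : R := ComplexField.Normc.normc z.
Lemma nrmM z w : nrm (z * w) = nrm z * nrm w.
Proof. exact: ComplexField.Normc.normcM. Qed.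
Lemma nrmE z : `|z| = (nrm z)%:C. Proof. by []. Qed.
Lemma nrm_ge0 z : 0 <= nrm z. Proof. by case: z => a b; exact: sqrtr_ge0. Qed.
Lemma nrm_eq0 z : nrm z = 0 -> z = 0. Proof. exact: ComplexField.Normc.eq0_normc. Qed.
Lemma nrm1 : nrm 1 = 1. Proof. exact: ComplexField.Normc.normc1. Qed.
Lemma nrmX z n : nrm (z ^+ n) = nrm z ^+ n.
Proof. by elim: n => [|n IH]; rewrite ?expr0 ?nrm1 // !exprS nrmM IH. Qed.
Lemma nrm_gt0 z : z != 0 -> 0 < nrm z.
Proof. by rewrite lt0r nrm_ge0 andbT; apply: contra => /eqP/nrm_eq0 ->. Qed.
Lemma nrm_le_nc z : nrm z <= nc z.
Proof. by have := norm_le_nc z; rewrite nrmE lecR. Qed.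
Lemma nrmB z w : nrm (z - w) <= nrm z + nrm w.
Proof. by rewrite -lecR real_complexD -!nrmE; exact: ler_normB. Qed.
Lemma nrm_nat n : nrm n%:R = n%:R.
Proof. by apply: complexI; rewrite -nrmE normr_nat rmorph_nat. Qed.

Lemma unit_circle z : nrm z = 1 -> exists x, z = cexpi x.
Proof.
case: z => a b /= /(congr1 (fun x => x ^+ 2)); rewrite expr1n sqr_sqrtr => [ab|]; last first.
  by rewrite addr_ge0 ?sqr_ge0.
have a1 : -1 <= a <= 1.
  rewrite -ler_norml -(@ler_pXn2r _ 2) ?nnegrE // real_normK ?num_real // expr1n.
  by rewrite -ab lerDl sqr_ge0.
have b2 : b ^+ 2 = 1 - a ^+ 2 by rewrite -ab; ring.
have sb : Num.sqrt (1 - a ^+ 2) = `|b| by rewrite -b2 sqrtr_sqr.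
have [b0|b0] := leP 0 b.
  exists (acos a); rewrite /cexpi acosK ?sin_acos ?in_itv //= sb.
  by rewrite ger0_norm.
exists (- acos a); rewrite cexpiN /cexpi acosK ?sin_acos ?in_itv //= sb.
by rewrite ltr0_norm // opprK.
Qed.
End NormC.

Section Shift.
Variables (R : realType) (d : nat).
Notation Z := (Zd d).
Notation C := R[i].
Implicit Types (g h m : Z -> C) (t phi : tlist R d).

Definition unitk (j : 'I_d) : Z := [ffun i => (i == j)%:Z].

Section OneShift.
Variables (e : Z) (g : Z -> C) (B : R) (lam : C).
Hypothesis gB : forall k, nrm (g k) <= B.

Lemma shift_iter (h : Z -> C) n k : (forall k, h (k - e) = lam * h k) ->
  h (k - e *+ n) = lam ^+ n * h k.
Proof.
move=> H; elim: n k => [|n IH] k; first by rewrite subr0 expr0 mul1r.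
by rewrite mulrS opprD addrA IH H exprSr mulrA.
Qed.

(** Shifting forwards bounds the powers of |lam|, shifting backwards those of its inverse, both
    against one nonzero value of [g]. *)
Lemma eigen_unimodular : (forall k, g (k - e) = lam * g k) -> (exists k, g k != 0) -> nrm lam = 1.
Proof.
move=> H [k gk]; have gk0 := nrm_gt0 gk.
apply/eqP; rewrite eq_le; apply/andP; split.
  apply: (@expn_bounded _ _ (B / nrm (g k))) => n.
  by rewrite ler_pdivlMr // -nrmX -nrmM -(shift_iter n k H).
have l0 : 0 < nrm lam.
  apply: nrm_gt0; apply: contra gk => /eqP l0.
  by rewrite -(addrK e k) -[_ + e - e]/(k + e - e) H l0 mul0r.
rewrite -invf_le1 //; apply: (@expn_bounded _ _ (B / nrm (g k))) => n.
rewrite ler_pdivlMr // exprVn mulrC ler_pdivrMr ?exprn_gt0 //.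
rewrite -{1}(addrK (e *+ n) k) (shift_iter n _ H) nrmM nrmX mulrC.
by rewrite ler_wpM2r ?exprn_ge0 ?nrm_ge0.
Qed.
End OneShift.

(** On a Jordan block S^n g = lam^n g + n lam^(n-1) h, which grows linearly in n while g stays
    bounded. *)
Lemma no_jordan_block e g B lam h : (forall k, nrm (g k) <= B) ->
  (forall k, h k = g (k - e) - lam * g k) -> (forall k, h (k - e) = lam * h k) ->
  forall k, h k = 0.
Proof.
move=> gB hE hS k; apply/eqP; apply: contraT => hk; exfalso.
have hB l : nrm (h l) <= B + nrm lam * B.
  by rewrite hE; apply: le_trans (nrmB _ _) _; rewrite nrmM lerD // ler_wpM2l ?nrm_ge0.
have l1 : nrm lam = 1 by apply: (eigen_unimodular hB hS); exists k.
(* Multiplying by [lam] avoids the exponent n - 1. *)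
have it n : lam * g (k - e *+ n) = lam ^+ n.+1 * g k + n%:R * (lam ^+ n * h k).
  elim: n => [|n IH]; first by rewrite subr0 expr1 mul0r addr0.
  have -> : g (k - e *+ n.+1) = h (k - e *+ n) + lam * g (k - e *+ n).
    by rewrite hE subrK; congr g; rewrite mulrSr opprD addrA.
  rewrite IH (shift_iter n k hS) -natr1 !exprS; ring.
have : nrm (h k) <= 0.
  apply: (@linear_bounded _ _ (B + B)) => n.
  have -> : n%:R * nrm (h k) = nrm (lam * g (k - e *+ n) - lam ^+ n.+1 * g k).
    by rewrite it addrC addKr !nrmM nrmX l1 expr1n mul1r nrm_nat.
  by apply: le_trans (nrmB _ _) _; rewrite !nrmM nrmX l1 expr1n !mul1r lerD.
by rewrite leNgt nrm_gt0.
Qed.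

Lemma shift_invariant (g : Z -> C) : (forall j k, g (k - unitk j) = g k) -> forall k, g k = g 0.
Proof.
move=> H k; have [n] := ubnP (knorm k); elim: n k => // n IH k kn.
have [->//|/eqP k0] := eqVneq k 0.
have [j kj] : exists j, k j != 0.
  apply: contrapT => no; apply: k0; apply/ffunP => j; rewrite ffunE; apply/eqP.
  by apply: contraT => kj; case: no; exists j.
have kn' (k' : Z) : (forall i, i != j -> k' i = k i) -> (`|k' j| < `|k j|)%N -> (knorm k' < n)%N.
  move=> hi hj; apply: leq_trans (_ : knorm k <= n)%N; last by [].
   rewrite /knorm (bigD1 j) //= [X in (_ < X)%N](bigD1 j) //=.
  rewrite (eq_bigr (fun i => `|k i|%N)) ?ltn_add2r // => i ij.
  by rewrite hi.
have [kpos|kneg] := ltP 0 (k j).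
  rewrite -(H j k); apply: IH; apply: kn' => [i /negbTE ij|]; rewrite !ffunE ?ij ?subr0 //.
  by rewrite eqxx; move: (k j) kpos => a; lia.
rewrite -[k in LHS](addrK (unitk j)) H; apply: IH; apply: kn' => [i /negbTE ij|].
  by rewrite !ffunE ij addr0.
by rewrite !ffunE eqxx; move: (k j) kj kneg => a; lia.
Qed.

Lemma hermitian_act phi m : Defs.hermitian (coef phi) -> Defs.hermitian m -> Defs.hermitian (act phi m).
Proof.
move=> hphi hm k; rewrite /act.
have E : (lin (fun l => m (k - l)) phi)^* = lin (fun l => m (- k - l)) (tconj phi).
  rewrite lin_conj; congr (_ ^*); apply: lin_ext => l.
  by rewrite -hm opprD !opprK.
rewrite E; apply: lin_coef_eq => l.
by rewrite coef_conj hphi conjcK.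
Qed.


Lemma act_cat t1 t2 m k : act (t1 ++ t2) m k = act t1 m k + act t2 m k.
Proof. exact: lin_cat. Qed.
Lemma act_scale a t m k : act (tscale a t) m k = a * act t m k.
Proof. exact: lin_scale. Qed.
Lemma act_shift j phi m k : act (tmul [:: (unitk j, 1)] phi) m k = act phi m (k - unitk j).
Proof.
rewrite /act lin_mul {1}/lin big_seq1 mul1r; apply: lin_ext => l.
by rewrite opprD addrA.
Qed.
Lemma act_one m k : act [:: (0, 1)] m k = m k.
Proof. by rewrite /act /lin big_seq1 mul1r subr0. Qed.

Lemma act_complex_parts phi m k : act phi m k =
  act (trealpart phi) m k + 'i * act (trealpart (tscale (- 'i) phi)) m k.
Proof.
rewrite -act_scale -act_cat; apply: lin_coef_eq => l; rewrite coef_cat coef_scale.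
rewrite !(coef_scale (2^-1)%:C) !coef_cat !coef_conj !coef_scale.
by apply: complex_eqP; rewrite !(cReD, cImD, cReM, cImM, cReJ, cImJ) /=; lra.
Qed.

End Shift.

(** * Simultaneous diagonalization of the shifts *)

Section DiscreteSpectrum.
Variables (R : realType) (d : nat).
Notation Z := (Zd d).
Notation C := R[i].
Variables (m : Z -> C) (B : R) (M : nat).
Hypothesis hm : Defs.hermitian m.
Hypothesis mB : forall k, nc (m k) <= B.
Hypothesis mdep : forall phi : 'I_M.+1 -> tlist R d, (forall i, Defs.hermitian (coef (phi i))) ->
  exists c : 'I_M.+1 -> R, (exists i, c i != 0) /\
    forall k, \sum_i (c i)%:C * act (phi i) m k = 0.

(** Real independence of the multiples of [m], not of the polynomials: distinct polynomials may
    agree on the support of a discrete measure. *)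
Definition indep n (phi : 'I_n -> tlist R d) : Prop :=
  (forall i, Defs.hermitian (coef (phi i))) /\
  forall c : 'I_n -> R, (forall k, \sum_i (c i)%:C * act (phi i) m k = 0) -> forall i, c i = 0.

Lemma max_indep : exists2 n, (n <= M)%N &
  (exists phi : 'I_n -> tlist R d, indep phi) /\ ~ exists phi : 'I_n.+1 -> tlist R d, indep phi.
Proof.
pose P n := `[< ~ exists phi : 'I_n -> tlist R d, indep phi >].
have PM : P M.+1.
  apply/asboolP => -[phi [rphi free]]; have [c [[i ci] c0]] := mdep rphi.
  by move: ci; rewrite (free c c0 i) eqxx.
have exP : exists n, P n by exists M.+1.
case: (ex_minnP exP) => -[|n] /asboolP Pn minn.
  case: Pn; exists (fun=> [::]); split; first by case.
  by move=> c _ [].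
exists n; first by have := minn _ PM.
split=> //; apply: contrapT => no.
have Pn' : P n by apply/asboolP.
by have := minn n Pn'; rewrite ltnn.
Qed.

Section Basis.
Variables (r : nat) (phi : 'I_r -> tlist R d).
Hypothesis phi_indep : indep phi.
Hypothesis phi_max : ~ exists psi : 'I_r.+1 -> tlist R d, indep psi.

Definition cmb (v : 'rV[C]_r) : Z -> C := fun k => \sum_i v 0 i * act (phi i) m k.

Lemma span_real psi : Defs.hermitian (coef psi) ->
  exists v : 'rV[C]_r, forall k, act psi m k = cmb v k.
Proof.
move=> rpsi; have [rphi free] := phi_indep; apply: contrapT => no.
pose psi' (i : 'I_r.+1) := if unlift ord_max i is Some j then phi j else psi.
apply: phi_max; exists psi'; split.
  by move=> i; rewrite /psi'; case: unliftP => [j _|_].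
move=> c; have E k : \sum_i (c i)%:C * act (psi' i) m k =
    \sum_(i < r) (c (lift ord_max i))%:C * act (phi i) m k + (c ord_max)%:C * act psi m k.
  rewrite big_ord_recr /= {2}/psi' unlift_none; congr (_ + _); apply: eq_bigr => i _.
  have -> : widen_ord (leqnSn r) i = lift ord_max i.
    by apply: val_inj; rewrite /= /bump leqNgt ltn_ord.
  by rewrite /psi' liftK.
move=> c0; have [cm|cm] := eqVneq (c ord_max) 0.
  have cl i : c (lift ord_max i) = 0.
    apply: (free (fun i => c (lift ord_max i))) => k.
    by have := c0 k; rewrite E cm mul0r addr0.
  by move=> i; case: (unliftP ord_max i) => [j ->|->].
case: no; exists (\row_i (- c (lift ord_max i) / c ord_max)%:C) => k.
have cm' : (c ord_max)%:C != 0 by apply: contra cm => /eqP/complexI ->.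
apply: (mulfI cm'); have := c0 k; rewrite E => /eqP; rewrite addrC addr_eq0 => /eqP ->.
rewrite /cmb mulr_sumr -sumrN; apply: eq_bigr => i _; rewrite mxE mulrA -real_complexM.
have -> : c ord_max * (- c (lift ord_max i) / c ord_max) = - c (lift ord_max i).
  by rewrite mulrC divfK.
rewrite -mulNr; congr (_ * _).
by apply: complex_eqP => /=; rewrite ?oppr0.
Qed.

Lemma cmbD u v k : cmb (u + v) k = cmb u k + cmb v k.
Proof. by rewrite /cmb -big_split; apply: eq_bigr => i _; rewrite mxE mulrDl. Qed.
Lemma cmbZ a v k : cmb (a *: v) k = a * cmb v k.
Proof. by rewrite /cmb mulr_sumr; apply: eq_bigr => i _; rewrite mxE mulrA. Qed.

Lemma span_complex psi : exists v : 'rV[C]_r, forall k, act psi m k = cmb v k.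
Proof.
have [v1 h1] := span_real (trealpart_real psi).
have [v2 h2] := span_real (trealpart_real (tscale (- 'i) psi)).
by exists (v1 + 'i *: v2) => k; rewrite cmbD cmbZ -h1 -h2 -act_complex_parts.
Qed.

(** Hermitian sequences independent over the reals stay so over the complex numbers: conjugating a
    vanishing combination conjugates its coefficients, so their real and imaginary parts give
    vanishing combinations too. *)
Lemma cmb_inj v : (forall k, cmb v k = 0) -> v = 0.
Proof.
move=> v0; have [rphi free] := phi_indep.
have E k : \sum_i (v 0 i)^* * act (phi i) m k = 0.
  transitivity ((cmb v (- k))^*); last by rewrite v0 conjc0.
  rewrite /cmb rmorph_sum; apply: eq_bigr => i _.
  by rewrite rmorphM (hermitian_act (rphi i) hm) /= conjcK.
have vRe i : complex.Re (v 0 i) = 0.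
  apply: (free (fun i => complex.Re (v 0 i))) => k.
  transitivity ((2^-1)%:C * (cmb v k + \sum_i (v 0 i)^* * act (phi i) m k)); last first.
    by rewrite v0 E addr0 mulr0.
  rewrite /cmb -big_split mulr_sumr; apply: eq_bigr => j _.
  by apply: complex_eqP; rewrite !(cReD, cImD, cReM, cImM, cReJ, cImJ) /=; lra.
have vIm i : complex.Im (v 0 i) = 0.
  apply: (free (fun i => complex.Im (v 0 i))) => k.
  transitivity ((- 'i * (2^-1)%:C) * (cmb v k - \sum_i (v 0 i)^* * act (phi i) m k)); last first.
    by rewrite v0 E subr0 mulr0.
  rewrite /cmb -sumrB mulr_sumr; apply: eq_bigr => j _.
  by apply: complex_eqP; rewrite !(cReD, cImD, cReN, cImN, cReM, cImM, cReJ, cImJ) /=; lra.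
by apply/rowP => i; rewrite mxE; apply: complex_eqP; rewrite ?vRe ?vIm.
Qed.

Lemma cmb_bounded v : exists B', forall k, nrm (cmb v k) <= B'.
Proof.
exists (\sum_i nc (v 0 i) * (\sum_(p <- phi i) nc p.2 * B)) => k.
apply: le_trans (nrm_le_nc _) _; apply: le_trans (nc_sum _ _) _.
apply: ler_sum => i _; apply: le_trans (ncM _ _) _; rewrite ler_wpM2l ?nc_ge0 //.
apply: le_trans (nc_sum _ _) _; apply: ler_sum => p _; apply: le_trans (ncM _ _) _.
by rewrite ler_wpM2l ?nc_ge0.
Qed.

(** A shift of [act phi m] amounts to multiplying [phi] by an exponential, so it stays in the
    span. *)
Lemma shift_matrix : exists A : 'I_d -> 'M[C]_r,
  forall j v k, cmb (v *m A j) k = cmb v (k - unitk j).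
Proof.
have /choice[W HW] (ji : 'I_d * 'I_r) := span_complex (tmul [:: (unitk ji.1, 1)] (phi ji.2)).
exists (fun j => \matrix_(i, l) W (j, i) 0 l) => j v k.
have -> : v *m \matrix_(i, l) W (j, i) 0 l = \sum_i v 0 i *: W (j, i).
  apply/rowP => l; rewrite mxE summxE; apply: eq_bigr => i _.
  by rewrite !mxE.
have cmb_sum (F : 'I_r -> 'rV[C]_r) : cmb (\sum_i F i) k = \sum_i cmb (F i) k.
  elim/big_rec2: _ => [|i x y _ IH].
    by rewrite /cmb big1 // => i _; rewrite mxE mul0r.
  by rewrite cmbD -IH.
rewrite cmb_sum; apply: eq_bigr => i _; rewrite cmbZ -HW /=.
by rewrite act_shift.
Qed.

Lemma shift_matrix_comm A : (forall j v k, cmb (v *m A j) k = cmb v (k - unitk j)) ->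
  forall i j : 'I_d, A i *m A j = A j *m A i.
Proof.
move=> HA i j; apply/row_matrixP => l; apply/eqP; rewrite -subr_eq0; apply/eqP.
apply: cmb_inj => k; rewrite !rowE !mulmxA -scaleN1r cmbD cmbZ mulN1r !HA.
by apply/eqP; rewrite subr_eq0; apply/eqP; congr cmb; rewrite -!addrA [- _ - _]addrC.
Qed.

End Basis.

Lemma shift_diagonalizable r (phi : 'I_r.+1 -> tlist R d) (A : 'M[C]_r.+1) (e : Z) :
  indep phi -> (forall v k, cmb phi (v *m A) k = cmb phi v (k - e)) -> diagonalizable A.
Proof.
move=> ind HA; apply/diagonalizableP.
(* Each row of w(A) gives a bounded sequence killed by (S - z)^2; with no Jordan block, S - z
   already kills it. *)
have step (w : {poly C}) z : horner_mx A (w * ('X - z%:P) * ('X - z%:P)) = 0 ->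
    horner_mx A (w * ('X - z%:P)) = 0.
  have Xz : horner_mx A ('X - z%:P) = A - z%:M by rewrite rmorphB /= horner_mx_X horner_mx_C.
  rewrite !rmorphM /= Xz => H.
  apply/row_matrixP => l; rewrite row0 -[_ * _]/(_ *m _) row_mul.
  set u := row l _.
  have cu v k : cmb phi (v *m (A - z%:M)) k = cmb phi v (k - e) - z * cmb phi v k.
    by rewrite mulmxBr mul_mx_scalar -scaleNr cmbD cmbZ mulNr HA.
  have [Bu HBu] := cmb_bounded phi u.
  apply: (cmb_inj ind).
  refine (no_jordan_block HBu (cu u) _) => k.
  apply/eqP; rewrite -subr_eq0 -cu /u -row_mul -row_mul.
  move: H; rewrite -[_ * _ * _]/(_ *m _ *m _) => ->.
  by rewrite row0 /cmb big1 // => i _; rewrite mxE mul0r.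
(* Repeated roots of the minimal polynomial are dropped one by one, [q] collecting those kept. *)
have undup0 (zs : seq C) (q : {poly C}) : horner_mx A (q * \prod_(z <- zs) ('X - z%:P)) = 0 ->
    horner_mx A (q * \prod_(z <- undup zs) ('X - z%:P)) = 0.
  elim: zs q => //= z zs IH q; rewrite big_cons; case: ifPn => zin H.
    apply: IH; move: H; rewrite (big_rem z) //= mulrCA mulrA.
    set Q := \prod_(_ <- rem _ _) _.
    rewrite (_ : q * (_ * Q) = q * Q * ('X - z%:P)); last by rewrite [_ * Q]mulrC mulrA.
    move=> H; apply: step; move: H; congr (horner_mx A _ = 0).
    by rewrite [RHS]mulrC [in RHS]mulrA; ring.
  by rewrite big_cons mulrA; apply: IH; rewrite -mulrA.
have [zs Hzs] := closed_field_poly_normal (mxminpoly A).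
exists (undup zs); first exact: undup_uniq.
apply: mxminpoly_min; rewrite -[X in horner_mx A X]mul1r; apply: undup0; rewrite mul1r.
have := mx_root_minpoly A; rewrite {1}Hzs.
have /monicP -> := mxminpoly_monic A.
by rewrite scale1r.
Qed.

Theorem discrete_of_dependent : exists (K : nat) (x : 'I_K -> Td R d) (a : 'I_K -> R),
  (K <= M)%N /\ forall k, m k = \sum_(i < K) (a i)%:C * cexpi (- dotp (x i) k).
Proof.
have [r rM [[phi ind] phimax]] := max_indep; exists r.
suff [x [c Hc]] : exists (x : 'I_r -> Td R d) (c : 'I_r -> C),
    forall k, m k = \sum_i c i * cexpi (- dotp (x i) k).
  exists x, (fun i => complex.Re (c i)); split=> // k.
  (* By Hermitian symmetry the conjugate weights represent [m] as well; averaging leaves real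
     weights at the same knots. *)
  have E : m k = \sum_i (c i)^* * cexpi (- dotp (x i) k).
    rewrite -[LHS]conjcK -hm Hc rmorph_sum; apply: eq_bigr => i _.
    by rewrite rmorphM /= dotpNr opprK cexpiN.
  transitivity ((2^-1)%:C * (m k + m k)).
    by apply: complex_eqP; rewrite !(cReMl, cImMl, cReD, cImD); lra.
  rewrite {1}Hc E -big_split mulr_sumr; apply: eq_bigr => i _.
  by apply: complex_eqP; rewrite !(cReD, cImD, cReM, cImM, cReJ, cImJ) /=; lra.
case: r => [|r] in phi rM ind phimax *.
  have [v Hv] := span_complex ind phimax [:: (0, 1)].
  exists (fun _ _ => 0), (fun=> 0) => k; rewrite -(act_one m k) Hv /cmb !big_ord0.
  by [].
have [A HA] := shift_matrix ind phimax.
have : codiagonalizable [seq A j | j <- enum 'I_d].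
  apply/codiagonalizableP; split.
    move=> _ _ /mapP[i _ ->] /mapP[j _ ->]; 
    exact (shift_matrix_comm ind HA i j).
  by move=> _ /mapP[j _ ->]; exact: (shift_diagonalizable ind (HA j)).
move=> [P uP /allP Pd].
have /choice[D HD] j : exists D : 'rV[C]_r.+1, P *m A j = diag_mx D *m P.
  have /Pd /= /is_diag_mxP : A j \in [seq A j | j <- enum 'I_d] by rewrite map_f ?mem_enum.
  rewrite conjumx // => h; exists (\row_i (P *m A j *m invmx P) i i).
  rewrite -[LHS](mulmxKV uP); congr (_ *m P); apply/matrixP => a b; rewrite [RHS]mxE.
  have [->|ab] := eqVneq a b; first by rewrite mulr1n [RHS]mxE.
  by rewrite mulr0n; exact: h.
pose g i := cmb phi (row i P).
have gS i j k : g i (k - unitk j) = D j 0 i * g i k.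
  rewrite /g -HA -row_mul HD row_mul row_diag_mx -scalemxAl -rowE cmbZ.
  by [].
have gne i : exists k, g i k != 0.
  apply: contrapT => no; have : row i P = 0.
    by apply: (cmb_inj ind) => k; apply/eqP; apply: contraT => gk; case: no; exists k.
  move=> /(congr1 (fun v => v *m invmx P)); rewrite mul0mx -row_mul mulmxV // => /rowP/(_ i).
  by rewrite !mxE eqxx => /eqP; rewrite oner_eq0.
(* Row i of [P] is a common eigenvector; the arguments of its d eigenvalues are the coordinates of
   the i-th knot. *)
have /choice[X HX] (ij : 'I_r.+1 * 'I_d) : exists x, D ij.2 0 ij.1 = cexpi x.
  have [Bg HBg] := cmb_bounded phi (row ij.1 P).
  by apply: unit_circle; exact (eigen_unimodular HBg (gS ij.1 ij.2) (gne ij.1)).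
pose x i : Td R d := fun j => X (i, j).
have gE i k : g i k = g i 0 * cexpi (- dotp (x i) k).
  (* Divided by its exponential, [g i] is shift-invariant, hence constant. *)
  have := @shift_invariant R d (fun k => g i k * cexpi (dotp (x i) k)).
  have dotu j : dotp (x i) (unitk j) = X (i, j).
    rewrite /dotp (bigD1 j) //= big1 ?addr0 ?ffunE ?eqxx ?mulr1 // => l lj.
    by rewrite ffunE (negbTE lj) mulr0.
  move=> /(_ _ k) H; rewrite -[LHS]mulr1 -cexpi0 -(addrN (dotp (x i) k)) cexpiD mulrA H.
    rewrite (_ : dotp _ 0 = 0) ?cexpi0 ?mulr1 //.
    by rewrite /dotp big1 // => l _; rewrite ffunE mulr0.
  move=> j l; rewrite gS dotpDr dotpNr dotu cexpiD (HX (i, j)) /=.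
  by rewrite [cexpi (X _) * g i l]mulrC mulrACA -(cexpiD (X _)) addrN cexpi0 mulr1.
(* The sequence [m] is in the span, as its own multiple by the constant 1. *)
have [v Hv] := span_complex ind phimax [:: (0, 1)].
exists x, (fun i => (v *m invmx P) 0 i * g i 0) => k.
rewrite -(act_one m k) Hv -{1}(mulmxKV uP v).
transitivity (\sum_i (v *m invmx P) 0 i * g i k); last first.
  by apply: eq_bigr => i _; rewrite gE mulrA.
move: (v *m invmx P) => w; rewrite /g /cmb.
under [RHS]eq_bigr => i _ do rewrite mulr_sumr.
rewrite exchange_big; apply: eq_bigr => l _; rewrite mxE mulr_suml.
by apply: eq_bigr => i _; rewrite mxE mulrA.
Qed.

End DiscreteSpectrum.

(** * Extreme points *)

Section Splitting.
Variables (R : realType) (d : nat).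
Notation Z := (Zd d).
Implicit Types (t phi : tlist R d) (u v : Z -> R[i]).

Lemma TVnorm_le_unit v (A : R) :
  (forall t, (forall x, `|complex.Re (ev t x)| <= 1) -> `|lpair v t| <= A) ->
  (TVnorm v <= A%:E)%E.
Proof.
move=> H; apply: ge_ereal_sup => _ [q [rq qb] <-]; rewrite lee_fin -pair_list_of.
by apply: H => x; rewrite ev_list_of.
Qed.

Lemma ev_one x : ev [:: ((0 : Z), (1 : R[i]))] x = 1.
Proof.
rewrite /ev /lin big_seq1 mul1r (_ : dotp _ _ = 0) ?cexpi0 //.
by rewrite /dotp big1 // => j _; rewrite ffunE mulr0.
Qed.

(* If [|a|, |b| <= 1] then [|(1 + phi) a + (1 - phi) b| <= 2]; this plays the role of
   restricting a measure to two disjoint sets. *)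
Lemma TVnorm_split phi v (tau tau1 tau2 : R) : Defs.hermitian (coef phi) ->
  (forall x, `|complex.Re (ev phi x)| <= 1) -> tvb v tau ->
  TVnorm (act ([:: (0, 1)] ++ phi) v) = tau1%:E ->
  TVnorm (act ([:: (0, 1)] ++ tscale (-1)%:C phi) v) = tau2%:E ->
  tau1 + tau2 <= 2 * tau.
Proof.
move=> rphi phi1 vtau E1 E2.
set v1 := act _ v in E1; set v2 := act _ v in E2.
have key t1 t2 : (forall x, `|complex.Re (ev t1 x)| <= 1) ->
    (forall x, `|complex.Re (ev t2 x)| <= 1) -> lpair v1 t1 + lpair v2 t2 <= 2 * tau.
  move=> h1 h2; rewrite /v1 /v2 !pair_act -pair_cat.
  apply: le_trans (ler_norm _) _; rewrite mulrC; apply: vtau => x.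
  rewrite ev_cat !ev_mul !ev_cat !ev_one ev_scale cReD !cReM !cReD !cImD cReMl cImMl.
  rewrite Im_ev_real //= mulr0 addr0 mul0r mul0r !subr0.
  have := phi1 x; have := h1 x; have := h2 x; rewrite !ler_norml.
  move: (complex.Re _) (complex.Re (ev t1 x)) (complex.Re (ev t2 x)).
  move=> b a p /andP[? ?] /andP[? ?] /andP[? ?]; apply/andP; split; nra.
have neg t : (forall x, `|complex.Re (ev t x)| <= 1) ->
    forall x, `|complex.Re (ev (tscale (-1)%:C t) x)| <= 1.
  by move=> h x; rewrite ev_scale cReMl mulN1r normrN.
(* The two suprema are taken one after the other: over [t1] with [t2] fixed, then over [t2]. *)
have step t2 : (forall x, `|complex.Re (ev t2 x)| <= 1) -> tau1 <= 2 * tau - lpair v2 t2.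
  move=> h2; rewrite -lee_fin -E1; apply: TVnorm_le_unit => t1 h1.
  have := key _ _ h1 h2; have := key _ _ (neg _ h1) h2; rewrite pair_scale ler_norml.
  by move=> ? ?; apply/andP; lra.
have : tau2 <= 2 * tau - tau1.
  rewrite -lee_fin -E2; apply: TVnorm_le_unit => t2 h2.
  have := step _ h2; have := step _ (neg _ h2); rewrite pair_scale ler_norml.
  by move=> ? ?; apply/andP; lra.
by lra.
Qed.

Lemma lin_bigcat (G : Z -> R[i]) n (T : 'I_n -> tlist R d) :
  lin G (\big[cat/[::]]_i T i) = \sum_i lin G (T i).
Proof.
by elim/big_rec2: _ => [|i x y _ <-]; rewrite ?lin_cat // /lin big_nil.
Qed.

End Splitting.

Section Extreme.
Variables (R : realType) (d : nat) (Lh : Zd d -> R[i]) (s : seq (Zd d)).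
Notation Z := (Zd d).
Hypothesis hLh : Defs.hermitian Lh.
Hypothesis us : uniq s.
Hypothesis sP : forall k, (k \in s) = (Lh k == 0).
Hypothesis sLd : slow_growth (Ldag Lh).
Variables (M : nat) (nu : 'I_M -> (Z -> R[i])).
Hypothesis hnu : forall m, CL Lh (nu m).
Hypothesis hinj : forall p, in_null Lh p -> (forall m, wpair (nu m) p = 0) -> p = (fun _ => 0).
Variables (Ey : 'rV[R]_M -> \bar R) (lam : R).
Hypothesis Ege0 : forall w, (0 <= Ey w)%E.
Hypothesis lam0 : 0 < lam.
Variable a : R.
Hypothesis amin : forall g, ML Lh g -> (a%:E <= objective Lh nu Ey lam g)%E.

Local Notation V := (sublevel Lh nu Ey lam a).

Lemma hermitian_Ldag : Defs.hermitian (Ldag Lh).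
Proof.
move=> k; rewrite /Ldag LhN // hLh; case: ifP => _; first by rewrite conjc0.
by rewrite conjc_inv.
Qed.

Lemma Lapp_Ldag v : Lapp Lh (fun k => Ldag Lh k * v k) = off_null Lh v.
Proof.
apply/funext => k; rewrite /Lapp /Ldag /off_null.
by case: ifPn => k0; [rewrite mul0r mulr0|rewrite mulVKf].
Qed.

(** Discarding the null frequencies subtracts a trigonometric polynomial, itself of finite
    variation. *)
Lemma tvb_off_null v T : Defs.hermitian v -> tvb v T -> exists T', tvb (off_null Lh v) T'.
Proof.
move=> hv vT; have [_ hon] := (in_null_on_null hLh sP hv).1.
have E : on_null Lh v = coef (null_part s v) by apply/funext => k; rewrite (coef_null_part sP).
rewrite E in hon; have [T0 HT0] := tvb_trig hon.
exists (`|1| * T + `|-1| * T0); have := tvb_lin 1 (-1) vT HT0; congr tvb.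
apply/funext => k; rewrite -E {1}(split_null Lh v).
by apply: complex_eqP; rewrite !(cReD, cImD, cReMl, cImMl); lra.
Qed.

Lemma nullsp_fun_inj c : nullsp_fun c = (fun=> 0) :> (Z -> R[i]) -> c = 0 :> 'rV[R]_(size s).
Proof.
move=> c0; apply/rowP => i; rewrite [RHS]mxE.
have := congr1 (fun f => hart f (tnth (in_tuple s) i)) c0.
rewrite nullsp_funE unhartK /hart /= addr0 (bigD1 i) //= eqxx mulr1 big1 ?addr0 // => j ji.
by rewrite (inj_eq (elimT (@tuple_uniqP _ _ (in_tuple s)) us)) eq_sym (negbTE ji) mulr0.
Qed.

(* The [M + 1] weights and the [size s] null-space coordinates outnumber the
   [size s + M] constraints, so some nontrivial multiple [u] of [L f] is [L H]
   with [nu H = 0]; then [f +- eps H] stays in [V] and extremality kills [H]. *)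
Lemma extreme_dependent f : extreme_point V f ->
  forall phi : 'I_M.+1 -> tlist R d, (forall i, Defs.hermitian (coef (phi i))) ->
  exists c : 'I_M.+1 -> R, (exists i, c i != 0) /\
    forall k, \sum_i (c i)%:C * act (phi i) (Lapp Lh f) k = 0.
Proof.
move=> [[fM fa] fext] phi rphi; set m := Lapp Lh f.
have [tau Etau [tau0 mtau]] := TVnorm_fin fM; rewrite -/m in Etau mtau.
have hf : Defs.hermitian f by case: fM => [[]].
have hm : Defs.hermitian m := hermitian_Lapp hLh hf.
have hact i : Defs.hermitian (act (phi i) m) := hermitian_act (rphi i) hm.
pose h i k := Ldag Lh k * act (phi i) m k.
have hT i : exists T, tvb (Lapp Lh (h i)) T.
  have [b _ hb] := ev_bounded (phi i).
  by rewrite Lapp_Ldag; apply: tvb_off_null (hact i) (tvb_act (rphi i) hb mtau).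
(* A kernel vector (c, r) of [X] makes the combined multiple vanish at the null frequencies ([A11])
   and cancels the measurements of its lift by those of a null-space element ([A12], [A22]). *)
pose A11 := \matrix_(i < M.+1, j < size s) hart (act (phi i) m) (tnth (in_tuple s) j).
pose A12 := \matrix_(i < M.+1, j < M) wpair (nu j) (h i).
pose A22 := \matrix_(i < size s, j < M) wpair (nu j) (null_basis R i).
pose X := block_mx A11 A12 0 A22.
have /rowV0Pn[v vX v0] : kermx X != 0.
  rewrite kermx_eq0 /row_free neq_ltn; apply/orP; left.
  by apply: leq_ltn_trans (rank_leq_col _) _; rewrite [(size s + M)%N]addnC ltn_add2r.
move: vX => /sub_kermxP; rewrite -[v]hsubmxK; set c := lsubmx v; set r := rsubmx v.
rewrite /X mul_row_block mulmx0 addr0 => /eqP; rewrite -row_mx0 => /eqP/eq_row_mx[c11 c12].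
have c0 : c != 0.
  apply/eqP => c0; move: v0; rewrite -[v]hsubmxK -/c -/r c0 => /negP; apply.
  suff -> : r = 0 by rewrite row_mx0.
  apply: nullsp_fun_inj; apply: hinj; first exact: nullsp_fun_in_null.
  move=> j; have := nuvec_nullsp_fun hLh sP hnu r; rewrite -/A22.
  move: c12; rewrite c0 mul0mx add0r => -> /rowP/(_ j).
  by rewrite !mxE.
pose Phi := \big[cat/[::]]_i tscale (c 0 i)%:C (phi i).
have rPhi : Defs.hermitian (coef Phi).
  move=> k; rewrite /coef !lin_bigcat rmorph_sum; apply: eq_bigr => i _.
  rewrite !lin_scale -/(coef _ _) rphi /=.
  by apply: complex_eqP; rewrite !(cReJ, cImJ, cReMl, cImMl); lra.
pose u := act Phi m.
have uE k : u k = \sum_i (c 0 i)%:C * act (phi i) m k.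
  by rewrite /u /act lin_bigcat; apply: eq_bigr => i _; rewrite lin_scale.
have hu : Defs.hermitian u by exact: hermitian_act.
have hartu k : Lh k = 0 -> hart u k = 0.
  move=> k0; have : k \in s by rewrite sP k0 eqxx.
  move=> /(@tnthP _ _ (in_tuple s))[j ->].
  have /rowP/(_ j) := c11; rewrite [RHS]mxE mxE => e; apply: eq_trans e.
  rewrite /hart uE cRe_sum cIm_sum -big_split; apply: eq_bigr => i _ /=.
  by rewrite [A11 _ _]mxE cReMl cImMl mulrDr.
have u0 k : Lh k = 0 -> u k = 0.
  move=> k0; rewrite -(hartK hu) /unhart !hartu ?hLh ?k0 ?conjc0 //.
  by apply: complex_eqP => /=; lra.
pose hs k := \sum_i (c 0 i)%:C * h i k.
pose H k := 1%:C * hs k + 1%:C * nullsp_fun r k.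
have hsE k : hs k = Ldag Lh k * u k.
  by rewrite /hs uE mulr_sumr; apply: eq_bigr => i _; rewrite mulrCA.
have LH : Lapp Lh H = u.
  rewrite /H Lapp_lin; apply/funext => k.
  have [_ ->] := nullsp_fun_in_null hLh sP r; rewrite mulr0 addr0 mul1r.
  have -> : hs = fun k => Ldag Lh k * u k by apply/funext => l; exact: hsE.
  by rewrite Lapp_Ldag /off_null; case: eqP => // /u0 ->.
have [b b0 hb] := ev_bounded Phi.
have uT : tvb u (tau * b) := tvb_act rPhi hb mtau.
have hH : Defs.hermitian H.
  apply: hermitian_lin; last by case: (nullsp_fun_in_null hLh sP r) => [[]].
  by move=> k; rewrite !hsE hermitian_Ldag hu -rmorphM.
have HM : ML Lh H by apply: (ML_tvb hLh sP sLd hH (T := tau * b)); rewrite LH.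
have hsT : tvb (Lapp Lh hs) (tau * b).
  have -> : hs = fun k => Ldag Lh k * u k by apply/funext => l; exact: hsE.
  rewrite Lapp_Ldag (_ : off_null Lh u = u) //.
  by apply/funext => k; rewrite /off_null; case: eqP => // /u0 ->.
have nuH : nuvec nu H = 0.
  apply/rowP => j; rewrite [RHS]mxE mxE (wpair_lin hLh sP 1 1 (hnu j) hsT
    (tvb_Lapp_null (nullsp_fun_in_null hLh sP r))) !mul1r (wpair_sum hLh sP) //.
  have /rowP/(_ j) := c12; rewrite [RHS]mxE mxE -(nuvec_nullsp_fun hLh sP hnu).
  rewrite [X in _ + X]mxE mxE => e; apply: eq_trans e; congr (_ + _).
  by apply: eq_bigr => i _; rewrite [A12 _ _]mxE.
(* This scaling gives |eps Phi| <= 1, as the splitting of the total variation demands. *)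
pose eps := b^-1; have eps0 : 0 < eps by rewrite invr_gt0.
pose fp (sg : R) k := 1%:C * f k + (sg * eps)%:C * H k.
have fpM sg : ML Lh (fp sg) by exact: ML_lin.
have nufp sg : nuvec nu (fp sg) = nuvec nu f.
  by rewrite (nuvec_lin hLh sP hnu) // nuH scaler0 addr0 scale1r.
have Lfp sg : Lapp Lh (fp sg) = act ([:: (0, 1)] ++ tscale sg%:C (tscale eps%:C Phi)) m.
  rewrite /fp Lapp_lin LH; apply/funext => k; rewrite act_cat act_one !act_scale -/u -/m.
  by rewrite mul1r real_complexM mulrA.
have [tau1 E1 _] := TVnorm_fin (fpM 1); have [tau2 E2 _] := TVnorm_fin (fpM (-1)).
have le2 : tau1 + tau2 <= 2 * tau.
  apply: (TVnorm_split (phi := tscale eps%:C Phi) _ _ mtau).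
  - by move=> k; rewrite !coef_scale rPhi; apply: complex_eqP;
      rewrite !(cReJ, cImJ, cReMl, cImMl); lra.
  - move=> x; rewrite ev_scale cReMl normrM gtr0_norm // /eps mulrC ler_pdivrMr //.
    by rewrite mul1r.
  - rewrite -E1 Lfp; congr TVnorm; apply/funext => k.
    by rewrite !act_cat !act_scale mul1r.
  - by rewrite -E2 Lfp.
have [e Ee] : exists e : R, Ey (nuvec nu f) = e%:E.
  have := Ege0 (nuvec nu f); move: fa; rewrite /objective Etau -EFinM.
  by case: (Ey _) => [e| |] // _ _; exists e.
have Jf : e + lam * tau <= a.
  by move: fa; rewrite /objective Ee Etau -EFinM -EFinD lee_fin.
have Jp sg t : TVnorm (Lapp Lh (fp sg)) = t%:E -> objective Lh nu Ey lam (fp sg) = (e + lam * t)%:E.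
  by move=> Et; rewrite /objective nufp Ee Et -EFinM -EFinD.
(* The data term is unchanged along [fp], so minimality gives tau <= tau1 and tau <= tau2; with tau1
   + tau2 <= 2 tau all three coincide. *)
have ge sg t : TVnorm (Lapp Lh (fp sg)) = t%:E -> tau <= t.
  move=> Et; have := amin (fpM sg); rewrite (Jp _ _ Et) lee_fin => h1.
  by rewrite -(ler_pM2l lam0); lra.
have t1 := ge _ _ E1; have t2 := ge _ _ E2.
have Vp sg t : TVnorm (Lapp Lh (fp sg)) = t%:E -> t <= tau -> V (fp sg).
  move=> Et tt; split; first exact: fpM.
  rewrite (Jp _ _ Et) lee_fin; apply: le_trans Jf; rewrite lerD2l.
  by rewrite ler_pM2l.
have V1 : V (fp 1) by apply: Vp E1 _; lra.
have V2 : V (fp (-1)) by apply: Vp E2 _; lra.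
have fcomb : f = comb 2^-1 (fp 1) (fp (-1)).
  apply/funext => k; rewrite /comb /fp.
  by apply: complex_eqP; rewrite !(cReD, cImD, cReMl, cImMl); lra.
have half : 0 < (2^-1 : R) < 1 by rewrite invr_gt0 ltr0n invf_lt1 // ltr1n.
have eqf := fext _ _ _ V1 V2 half fcomb.
have H0 k : H k = 0.
  have /(congr1 (fun q => q k)) := eqf; rewrite /fp => e'.
  apply: complex_eqP; [have := congr1 (@complex.Re R) e'|have := congr1 (@complex.Im R) e'];
    rewrite !(cReD, cImD, cReMl, cImMl) /= => e''; 
    by apply: (@mulfI _ eps); [rewrite gt_eqF|lra].
exists (c 0); split.
  apply: contrapT => no; move: c0 => /eqP; apply; apply/rowP => i; rewrite [RHS]mxE.
  by apply/eqP; apply: contraT => ci; case: no; exists i.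
move=> k; rewrite -uE -LH /Lapp H0 mulr0.
by [].
Qed.

(** Off the null frequencies f is [Ldag] applied to the discrete L f, on them it is p. The condition
    on the weights says that L f vanishes at the null frequencies. *)
Lemma extreme_spline f : extreme_point V f ->
  exists (K : nat) (x : 'I_K -> Td R d) (w : 'I_K -> R) (p : Z -> R[i]),
    (K <= M)%N /\ in_null Lh p /\
    f = (fun k => \sum_(i < K) (w i)%:C * Ldag Lh k * cexpi (- dotp (x i) k) + p k) /\
    (forall k0, Lh k0 = 0 -> \sum_(i < K) (w i)%:C * cexpi (- dotp (x i) k0) = 0).
Proof.
move=> fext; have [[fM fa] _] := fext.
have [tau Etau [tau0 mtau]] := TVnorm_fin fM.
have hf : Defs.hermitian f by case: fM => [[]].
have [K [x [w [KM mE]]]] := discrete_of_dependent (hermitian_Lapp hLh hf)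
  (fun k => nc_le_tvb k mtau) (extreme_dependent fext).
exists K, x, w, (on_null Lh f); split=> //; split; first exact: in_null_on_null.
split=> [|k k0]; last by rewrite -mE /Lapp k0 mul0r.
apply/funext => k; rewrite (eq_bigr (fun i => Ldag Lh k * ((w i)%:C * cexpi (- dotp (x i) k)))).
  rewrite -mulr_sumr -mE /Lapp /Ldag /on_null.
  by case: ifPn => k0; [rewrite mul0r add0r|rewrite mulKf // addr0].
by move=> i _; rewrite mulrA [Ldag _ _ * _]mulrC.
Qed.

End Extreme.

Theorem mainTheorem5 (R : realType) (d : nat) (Lh : Zd d -> R[i]) (M : nat)
    (nu : 'I_M -> (Zd d -> R[i])) (E : 'rV[R]_M -> 'rV[R]_M -> \bar R)
    (y : 'rV[R]_M) (lam : R) :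
  (0 < d)%N ->
  spline_admissible Lh ->
  (* measurement functionals in C_L *)
  (forall m, CL Lh (nu m)) ->
  (* linear independence of nu_1, ..., nu_M *)
  (forall c : 'I_M -> R,
     (fun k => \sum_(m < M) (c m)%:C * nu m k) = (fun _ => 0) -> forall m, c m = 0) ->
  (* M >= N_0 *)
  (forall s : seq (Zd d), uniq s -> (forall k, k \in s -> Lh k = 0) -> (size s <= M)%N) ->
  (* nu injective on N_L *)
  (forall p, in_null Lh p -> (forall m, wpair (nu m) p = 0) -> p = (fun _ => 0)) ->
  (* E(z, .) has values in R_+ u {oo}, is lsc, convex, coercive and proper *)
  (forall z w : 'rV[R]_M, (0 <= E z w)%E) ->
  (forall z, lower_semicontinuous (E z)) ->
  (forall (z w1 w2 : 'rV[R]_M) (t : R), 0 <= t <= 1 ->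
     (E z (t *: w1 + (1 - t) *: w2)%R <= t%:E * E z w1 + ((1 - t)%R)%:E * E z w2)%E) ->
  (forall z (A : R), exists r : R, forall w : 'rV[R]_M, r < `|w| -> (A%:E < E z w)%E) ->
  (forall z, exists w, (E z w < +oo)%E) ->
  0 < lam ->
  let V := solution_set Lh nu E y lam in
  (exists f, V f) /\ real_convex_set V /\ wstar_compact Lh V /\
  forall f, extreme_point V f ->
    exists (K : nat) (x : 'I_K -> Td R d) (a : 'I_K -> R) (p : Zd d -> R[i]),
      (K <= M)%N /\ in_null Lh p /\
      f = (fun k => \sum_(i < K) (a i)%:C * Ldag Lh k * cexpi (- dotp (x i) k) + p k) /\
      (forall k0, Lh k0 = 0 -> \sum_(i < K) (a i)%:C * cexpi (- dotp (x i) k0) = 0).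
Proof.
move=> _ Ladm nuCL nufree nullM nuinj Ege0 Elsc Econv Ecoer Eprop lam0 V.
have hLh : Defs.hermitian Lh by case: Ladm => [[]].
have sLd := Ldag_slow Ladm.
have [s us sP] := null_list nullM.
have nuh m : Defs.hermitian (nu m) by case: (nuCL m) => [[]].
have [w0 w0fin] := Eprop y.
have [f0 f0M f0w] := nuvec_surj hLh sP sLd nuh nufree w0.
have J0 : (objective Lh nu (E y) lam f0 < +oo)%E.
  have [tau Etau _] := TVnorm_fin f0M.
  by rewrite /objective f0w Etau lte_add_pinfty // -EFinM ltry.
have [a [[f1 f1a] amin]] := sublevel_min hLh us sP sLd nuCL nuinj (Ege0 y) (Elsc y)
  (Ecoer y) lam0 f0M J0.
(* As [a] is the attained minimum, minimizing the objective means not exceeding [a]. *)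
have -> : V = sublevel Lh nu (E y) lam a.
  apply/seteqP; split=> f [fM fmin]; split=> //.
    by apply: le_trans (fmin _ f1a.1) f1a.2.
  by move=> g gM; apply: le_trans fmin _; exact: amin.
split; first by exists f1.
split; first exact: (sublevel_convex hLh sP sLd nuCL (Ege0 y) (Econv y) lam0).
split; first exact: (sublevel_wstar_compact hLh us sP sLd nuCL nuinj (Ege0 y) (Elsc y) (Ecoer y) lam0).
move=> f; exact: (extreme_spline hLh us sP sLd nuCL nuinj (Ege0 y) lam0 amin).
Qed.
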